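(* For every integer $k\geq 0$ there is a veering triangulation $\mathcal{V}_k$ with exactly $8+k$ tetrahedra whose veering polynomial vanishes.
   Context: **Ideal triangulations.** Let $M$ be a compact, connected, oriented 3-manifold. An ideal triangulation of $M$ is a decomposition of $M\setminus\partial M$ into finitely many ideal tetrahedra whose triangular faces are identified in pairs by homeomorphisms sending vertices to vertices. Its dual 2-complex (dual spine) $\mathcal{D}$ has a vertex for every tetrahedron, an edge for every face and a 2-cell for every edge of the triangulation. The 1-skeleton of $\mathcal{D}$ is the dual graph $\Gamma$. **Taut triangulations.** A taut structure is a choice of orientations on the edges of $\Gamma$ such that (1) every vertex of $\Gamma$ has two incoming and two outgoing edges; (2) every 2-cell $\sigma$ of $\mathcal{D}$ has exactly one vertex (its bottom vertex) such that the two edges of $\sigma$ adjacent to it both point out of it; (3) every 2-cell $\sigma$ has exactly one vertex (its top vertex) such that the two edges of $\sigma$ adjacent to it both point into it. Dually, the faces of the triangulation are cooriented. The two faces of a tetrahedron $t$ whose coorientations point out of $t$ are its top faces, and their common edge is the top diagonal of $t$. The other two faces are its bottom faces, and their common edge is the bottom diagonal of $t$. The remaining four edges of $t$ are called equatorial. Each face is a bottom face of exactly one tetrahedron, said to be immediately above it. A taut triangulation is an ideal triangulation with a taut structure. **Veering triangulations.** A veering structure on a taut triangulation is a smoothing of the dual spine into a branched surface with prescribed local form around every vertex. Combinatorially: for each face $f$ let its large edge be the bottom diagonal of the tetrahedron immediately above $f$. The taut triangulation is veering if for every tetrahedron $t$ the large edges of the two top faces of $t$ are two opposite (disjoint) equatorial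 edges of $t$. Equivalently (classical definition): the edges can be coloured red and blue so that for every tetrahedron $t$, viewed from above (coorientations pointing towards the viewer), traversing the boundary of each top face of $t$ counterclockwise starting at the top diagonal one meets next a red and then a blue edge, and traversing the boundary of each bottom face of $t$ counterclockwise starting at the bottom diagonal one meets next a blue and then a red edge. **Veering polynomial (Landry--Minsky--Taylor).** Let $\mathcal{V}$ be a veering triangulation of $M$ with set of tetrahedra $T$ and set of edges $E$ ($|T|=|E|=n$). Let $H=H_1(M;\mathbb{Z})/\text{torsion}$, written multiplicatively, and let $M^{fab}\to M$ be the cover associated to the kernel of $\pi_1(M)\to H$; its deck group is $H$, and it carries the lifted veering triangulation $\mathcal{V}^{fab}$. Choosing one lift of each simplex, identify the free abelian groups on tetrahedra and edges of $\mathcal{V}^{fab}$ with the free $\mathbb{Z}[H]$-modules $\mathbb{Z}[H]^T$ and $\mathbb{Z}[H]^E$. For a tetrahedron $\tilde t$ of $\mathcal{V}^{fab}$ let $b$ be its bottom diagonal, $u$ its top diagonal, and $s_1,s_2$ its two equatorial edges whose colour is different from the colour of $u$. Define the $\mathbb{Z}[H]$-linear map $L:\mathbb{Z}[H]^T\to\mathbb{Z}[H]^E$ by $L(\tilde t)=b-(u+s_1+s_2)$. The veering polynomial of $\mathcal{V}$ is $\det L\in\mathbb{Z}[H]$, well defined up to units $\pm h$, $h\in H$. *)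

(* Defs.v *)
From HB Require Import structures.
From Stdlib Require Import Relation_Operators.
From mathcomp Require Import all_boot all_order all_algebra all_fingroup.
From mathcomp Require Import finmap.
From mathcomp Require Import monalg.

Set Implicit Arguments.
Unset Strict Implicit.
Unset Printing Implicit Defensive.

Import GRing.Theory.
Local Open Scope ring_scope.

(* The integral group ring Z[H] of an abelian group H. The group law of H is
   written additively, as for any zmodType: the product of the basis elements
   << x >> and << y >> is << x + y >>. The additive group is the one of monalg;
   its product is not available, as it excludes monoids with inverses. *)
Definition group_ring (H : zmodType) : Type := {malg int[H]}.

Section GroupRing.
Variable H : zmodType.
HB.instance Definition _ := GRing.Zmodule.on (group_ring H).

Implicit Types (g : group_ring H) (x y : H).

Definition grp_elt x : group_ring H := << 1 *g x >>.

Definition gr_mul g1 g2 : group_ring H :=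
  \sum_(x <- msupp g1) \sum_(y <- msupp g2) << g1@_x * g2@_y *g x + y >>.

Lemma gr_mulw (d1 d2 : {fset H}) g1 g2 :
  (msupp g1 `<=` d1)%fset -> (msupp g2 `<=` d2)%fset ->
  gr_mul g1 g2 = \sum_(x <- d1) \sum_(y <- d2) << g1@_x * g2@_y *g x + y >>.
Proof.
move=> le_d1 le_d2; rewrite /gr_mul (big_fset_incl _ le_d1) /=.
  apply/eq_bigr=> k1 _; apply/big_fset_incl => // k _ /mcoeff_outdom ->.
  by rewrite mulr0 monalgU0.
move=> k _ /mcoeff_outdom g1k.
by rewrite big1 => // k' _; rewrite g1k mul0r monalgU0.
Qed.

Lemma gr_mulC : commutative gr_mul.
Proof.
move=> g1 g2; rewrite /gr_mul exchange_big /=.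
by apply/eq_bigr=> k1 _; apply/eq_bigr=> k2 _; rewrite mulrC addrC.
Qed.

Lemma gr_mul0g : left_zero 0 gr_mul.
Proof. by move=> g; rewrite /gr_mul msupp0 big_seq_fset0. Qed.

Lemma gr_mulUU (a b : int) x y :
  gr_mul << a *g x >> << b *g y >> = << a * b *g x + y >>.
Proof. by rewrite (gr_mulw msuppU_le msuppU_le) !big_seq_fset1 !mcoeffUU. Qed.

Lemma gr_mulUg (a : int) x g :
  gr_mul << a *g x >> g = \sum_(y <- msupp g) << a * g@_y *g x + y >>.
Proof.
rewrite (gr_mulw msuppU_le (fsubset_refl _)) big_seq_fset1.
by apply/eq_bigr => k' _; rewrite mcoeffUU.
Qed.

Lemma gr_mul1g : left_id (grp_elt 0) gr_mul.
Proof.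
move=> g; rewrite gr_mulUg [RHS]monalgE.
by apply/eq_bigr=> kg _; rewrite mul1r add0r.
Qed.

Lemma gr_mulDl : left_distributive gr_mul +%R.
Proof.
move=> g1 g2 g.
rewrite [in RHS](gr_mulw (fsubsetUl _ (msupp g2)) (fsubset_refl _)).
rewrite [in RHS](gr_mulw (fsubsetUr (msupp g1) _) (fsubset_refl _)).
rewrite (gr_mulw (msuppD_le _ _) (fsubset_refl _)).
rewrite -big_split /=; apply/eq_bigr=> k1 _.
rewrite -big_split /=; apply/eq_bigr=> k2 _.
by rewrite mcoeffD mulrDl monalgUD.
Qed.

Lemma gr_mulEl g1 g2 :
  gr_mul g1 g2 = \sum_(x <- msupp g1) gr_mul << g1@_x *g x >> g2.
Proof. by apply/eq_bigr=> k _; rewrite gr_mulUg. Qed.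

Lemma gr_mulEr g1 g2 :
  gr_mul g1 g2 = \sum_(y <- msupp g2) gr_mul g1 << g2@_y *g y >>.
Proof.
by rewrite gr_mulC gr_mulEl; apply/eq_bigr=> k _; rewrite gr_mulC.
Qed.

Lemma gr_mulA : associative gr_mul.
Proof.
have mulg0 : right_zero 0 gr_mul by move=> g; rewrite gr_mulC gr_mul0g.
have mulDr : right_distributive gr_mul +%R.
  by move=> g g1 g2; rewrite gr_mulC gr_mulDl !(gr_mulC _ g).
move=> g1 g2 g3.
rewrite [in RHS](gr_mulEl g1).
rewrite [RHS](big_morph (gr_mul^~ _) (fun _ _ => gr_mulDl _ _ _) (gr_mul0g _)).
rewrite gr_mulEl; apply/eq_bigr=> k1 _.
rewrite [in LHS](gr_mulEl g2).
rewrite [LHS](big_morph (gr_mul _) (fun _ _ => mulDr _ _ _) (mulg0 _)).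
rewrite [in RHS](gr_mulEr _ g2).
rewrite [RHS](big_morph (gr_mul^~ _) (fun _ _ => gr_mulDl _ _ _) (gr_mul0g _)).
apply/eq_bigr=> k2 _.
rewrite [in LHS](gr_mulEr _ g3).
rewrite [LHS](big_morph (gr_mul _) (fun _ _ => mulDr _ _ _) (mulg0 _)).
by rewrite [RHS]gr_mulEr; apply/eq_bigr=> k3 _; rewrite !gr_mulUU mulrA addrA.
Qed.

Lemma gr_one_neq0 : grp_elt 0 != 0.
Proof. by rewrite /grp_elt monalgU_eq0. Qed.

HB.instance Definition _ := GRing.Zmodule_isComNzRing.Build (group_ring H)
  gr_mulA gr_mulC gr_mul1g gr_mulDl gr_one_neq0.
End GroupRing.

(* Tetrahedra have vertices 0, 1, 2, 3 : 'I_4, numbered so that the order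
   0, 1, 2, 3 is positive: det (v1 - v0, v2 - v0, v3 - v0) > 0. Face i of a
   tetrahedron is the one opposite to its vertex i; an edge is the set p of its
   two end points, so that the faces containing p are those with i \notin p.
   If glue t i = (t', s), then face i of t is glued to face s i of t' by the
   restriction of s to the vertices distinct from i. The gluings are
   orientation-reversing, so the permutations are odd; in particular no edge is
   identified with its own reverse. T may be infinite, so as to include
   covers. *)
Record triangulation (T : Type) := Triangulation {
  glue : T -> 'I_4 -> T * 'S_4;
  glueK : forall t i,
    glue (glue t i).1 ((glue t i).2 i) = (t, ((glue t i).2)^-1%g);
  glue_neq : forall t i, ((glue t i).1, (glue t i).2 i) <> (t, i);
  glue_odd : forall t i, odd_perm (glue t i).2
}.

Section Triangulation.
Variables (T : Type) (tri : triangulation T).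

Definition tri_connected : Prop :=
  forall t t' : T,
    clos_refl_trans T (fun x y => exists i, y = (glue tri x i).1) t t'.

(* (t, i) stands for face i of t seen from t, or for the edge of the dual graph
   crossing this face, oriented out of t; flip is the other side of the face,
   or the reversed dual edge. *)
Definition flip (h : T * 'I_4) : T * 'I_4 :=
  ((glue tri h.1 h.2).1, (glue tri h.1 h.2).2 h.2).

(* A corner (t, p), #|p| = 2, is an edge of a tetrahedron. The edges of the
   triangulation are the classes of corners under same_edge. The 2-cell dual to
   an edge has the corners in the class as its vertices; the two edges of this
   2-cell adjacent to (t, p) are dual to the faces i of t with i \notin p. *)
Definition edge_step (c c' : T * {set 'I_4}) : Prop :=
  exists2 i, i \notin c.2 &
    c' = ((glue tri c.1 i).1, [set (glue tri c.1 i).2 v | v in c.2]).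

Definition same_edge : T * {set 'I_4} -> T * {set 'I_4} -> Prop :=
  clos_refl_trans _ edge_step.

(* out t i means that the coorientation of face i of t points out of t. *)
Record taut_structure := TautStructure {
  out : T -> 'I_4 -> bool;
  out_flip : forall h, out (flip h).1 (flip h).2 = ~~ out h.1 h.2;
  out_card : forall t, #|[set i | out t i]| = 2%N;
  taut_bottom : forall t (p : {set 'I_4}), #|p| = 2%N ->
    exists! c, same_edge (t, p) c /\ (forall i, i \notin c.2 -> out c.1 i);
  taut_top : forall t (p : {set 'I_4}), #|p| = 2%N ->
    exists! c, same_edge (t, p) c /\ (forall i, i \notin c.2 -> ~~ out c.1 i)
}.

Variable ts : taut_structure.

(* The top faces are opposite to the vertices i with out t i, hence their
   common edge is spanned by the two other vertices. *)
Definition top_diag (t : T) : {set 'I_4} := [set i | ~~ out ts t i].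
Definition bottom_diag (t : T) : {set 'I_4} := [set i | out ts t i].

Definition equatorial (t : T) (p : {set 'I_4}) : bool :=
  [&& #|p| == 2%N, p != top_diag t & p != bottom_diag t].

(* Viewed from above, s 1, s 2, s 3 is the counterclockwise order of the
   vertices of face s 0 of t. Viewed from outside t this holds if and only if
   the order s 0, s 1, s 2, s 3 of the vertices of t is positive; the viewer is
   outside t for a top face, and on the side of t for a bottom face. *)
Definition ccw_from_above (t : T) (s : 'S_4) : Prop :=
  odd_perm s = ~~ out ts t (s 0).

(* The edges which are not red are blue. *)
Record veering_colouring := VeeringColouring {
  red : T -> {set 'I_4} -> bool;
  red_edge : forall c c' : T * {set 'I_4}, #|c.2| = 2%N -> same_edge c c' ->
    red c.1 c.2 = red c'.1 c'.2;
  veering_top : forall t (s : 'S_4),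
    out ts t (s 0) -> ccw_from_above t s -> [set s 1; s 2] = top_diag t ->
    red t [set s 2; s 3] /\ ~~ red t [set s 3; s 1];
  veering_bottom : forall t (s : 'S_4),
    ~~ out ts t (s 0) -> ccw_from_above t s -> [set s 1; s 2] = bottom_diag t ->
    ~~ red t [set s 2; s 3] /\ red t [set s 3; s 1]
}.
End Triangulation.

Record veering_triangulation (n : nat) := VeeringTriangulation {
  vt_tri :> triangulation 'I_n;
  vt_connected : tri_connected vt_tri;
  vt_taut : taut_structure vt_tri;
  vt_colour : veering_colouring vt_taut
}.

(* First homology of the dual 2-complex, onto which M retracts. *)
Section Homology.
Variables (T : finType) (tri : triangulation T).

Definition chain1 : Type := {ffun T * 'I_4 -> int}.

Definition dual_edge (h : T * 'I_4) : chain1 := [ffun h' => (h' == h)%:Z].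

Definition is_cycle (c : chain1) : Prop :=
  forall t, \sum_(h | (flip tri h).1 == t) c h = \sum_(h | h.1 == t) c h.

(* A flag (t, s) is the corner (t, [set s 0; s 1]) with an order of the two
   vertices of the edge, and of the two faces s 2 and s 3 containing it. It
   turns around the edge by leaving t through face s 2. *)
Definition turn (x : T * 'S_4) : T * 'S_4 :=
  ((glue tri x.1 (x.2 2)).1, (tperm 2 3 * x.2 * (glue tri x.1 (x.2 2)).2)%g).

Definition cell_boundary (x : T * 'S_4) : chain1 :=
  \sum_(y <- fingraph.orbit turn x) dual_edge (y.1, y.2 2).

(* Both orientations of a dual edge are generators of chain1, hence the
   first sum. *)
Definition is_boundary (c : chain1) : Prop :=
  exists (a : T * 'I_4 -> int) (b : T * 'S_4 -> int),
    c = \sum_h (dual_edge h + dual_edge (flip tri h)) *~ a h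
      + \sum_x cell_boundary x *~ b x.

Definition chain_eval (A : zmodType) (f : T * 'I_4 -> A) (c : chain1) : A :=
  \sum_h f h *~ c h.

(* The group H = H_1(M; Z) / torsion, together with the data of the cover
   M^fab: chain_eval fab_edge restricts to an epimorphism from the 1-cycles
   onto H, whose kernel is the set of cycles with torsion homology class. Its
   values on the individual dual edges depend on the identification of the set
   of tetrahedra of M^fab with T * H, on which H acts by translations. *)
Record fab_cover := FabCover {
  fab_grp : zmodType;
  fab_edge : T * 'I_4 -> fab_grp;
  fab_flip : forall h, fab_edge (flip tri h) = - fab_edge h;
  fab_surj : forall x, exists2 c, is_cycle c & chain_eval fab_edge c = x;
  fab_ker : forall c, is_cycle c ->
    chain_eval fab_edge c = 0 <-> exists2 m, (0 < m)%N & is_boundary (c *+ m)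
}.

Variable C : fab_cover.
Local Notation H := (fab_grp C).

Definition cover_glue (u : T * H) (i : 'I_4) : (T * H) * 'S_4 :=
  (((glue tri u.1 i).1, u.2 + fab_edge C (u.1, i)), (glue tri u.1 i).2).

Fact cover_glueK u i :
  cover_glue (cover_glue u i).1 ((cover_glue u i).2 i)
    = (u, ((cover_glue u i).2)^-1%g).
Proof.
case: u => t x; rewrite /cover_glue /= glueK /=.
by rewrite (fab_flip C (t, i)) addrK.
Qed.

Fact cover_glue_neq u i : ((cover_glue u i).1, (cover_glue u i).2 i) <> (u, i).
Proof.
case: u => t x; rewrite /cover_glue /= => -[eq_t _ eq_i].
by apply: (@glue_neq _ tri t i); rewrite eq_t eq_i.
Qed.

Fact cover_glue_odd u i : odd_perm (cover_glue u i).2.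
Proof. exact: glue_odd. Qed.

Definition cover_tri : triangulation (T * H) :=
  Triangulation cover_glueK cover_glue_neq cover_glue_odd.

Definition deck (x : H) (c : (T * H) * {set 'I_4}) : (T * H) * {set 'I_4} :=
  ((c.1.1, c.1.2 + x), c.2).
End Homology.

Section VeeringPolynomial.
Variables (n : nat) (V : veering_triangulation n) (C : fab_cover V).
Local Notation H := (fab_grp C).
Local Notation ZH := (group_ring H).

(* A numbering of the edges of V (there are as many as tetrahedra), a lift to
   V^fab of every tetrahedron and of every edge, and the resulting coordinates:
   the edge p of the lift of t is the image under the deck transformation
   edge_coord t p of the lift of the edge of V containing (t, p). *)
Record lifts := Lifts {
  edge_of : 'I_n -> {set 'I_4} -> 'I_n;
  edge_ofP : forall t (p : {set 'I_4}) t' (p' : {set 'I_4}),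
    #|p| = 2%N -> #|p'| = 2%N ->
    edge_of t p = edge_of t' p' <-> same_edge V (t, p) (t', p');
  tet_lift : 'I_n -> H;
  edge_lift : 'I_n -> ('I_n * H) * {set 'I_4};
  edge_lift_card : forall e, #|(edge_lift e).2| = 2%N;
  edge_liftK : forall e, edge_of (edge_lift e).1.1 (edge_lift e).2 = e;
  edge_coord : 'I_n -> {set 'I_4} -> H;
  edge_coordP : forall t (p : {set 'I_4}), #|p| = 2%N ->
    same_edge (cover_tri C) ((t, tet_lift t), p)
      (deck (edge_coord t p) (edge_lift (edge_of t p)))
}.

Variable B : lifts.

Definition edge_vec (t : 'I_n) (p : {set 'I_4}) : 'rV[ZH]_n :=
  grp_elt (edge_coord B t p) *: delta_mx 0 (edge_of B t p).

(* Row t is the image of the chosen lift of t. *)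
Definition veering_matrix : 'M[ZH]_n :=
  \matrix_(t < n)
    (edge_vec t (bottom_diag (vt_taut V) t)
     - (edge_vec t (top_diag (vt_taut V) t)
        + \sum_(p | equatorial (vt_taut V) t p
                    && (red (vt_colour V) t p
                          != red (vt_colour V) t (top_diag (vt_taut V) t)))
            edge_vec t p)).

Definition veering_polynomial : ZH := \det veering_matrix.
End VeeringPolynomial.

(* Main.v *)
Require Import Defs.
From Stdlib Require Import Relation_Operators.
From mathcomp Require Import all_boot all_order all_algebra all_fingroup.
From mathcomp Require Import zify ring lra.

Set Implicit Arguments.
Unset Strict Implicit.
Unset Printing Implicit Defensive.

Import GRing.Theory Num.Theory.
Local Open Scope ring_scope.

(** The veering polynomial is the determinant of a matrix with one row per
tetrahedron, so it vanishes as soon as two rows agree. The row of a tetrahedron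
is b - (u + s1 + s2). If, in the maximal free abelian cover, the bottom diagonal
b and the top diagonal u of the lifted tetrahedron are one and the same edge,
and if s1 and s2 are both the edge e, then the row collapses to - 2 e. Two
tetrahedra that collapse in this way to the same e make the determinant zero
([veering_polynomial_twin_rows]).

The triangulation V_k contains k + 2 such tetrahedra. It is made of
- five slabs 0, ..., 4, each lying with its two bottom faces on the two top
  faces of the previous one;
- a cap, one top face of which is glued to one of its own bottom faces;
- a ladder of rungs 0, ..., m with m = k + 1, where rung 0 has a top face glued
  to one of its own bottom faces, and two consecutive rungs are glued along two
  faces, each rung being once above and once below the other.
The cap and the ladder have one top face and one bottom face left; they connect
the two top faces of slab 4 with the two bottom faces of slab 0.

Let a and b be the loops of the dual graph given by the self-gluings of rung 0
and of the cap, and let d be the difference of the two dual edges from a slab to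
the next one, which is the same for all slabs. The 2-cells dual to the edges
show that the round trip between two consecutive rungs is homologous to 2 a, and
that
    b = (2 m + 1) a + 2 d    and    2 b = 2 a + 4 d
in homology ([potential_gauge]). Therefore 4 m a = 0, and a is torsion because
m > 0. As a consequence every loop in the ladder lifts to the free abelian
cover: there the two diagonals of each rung coincide, and all the blue edges of
the rungs are one edge. The terms in d cancel because four steps lead from
the first slab to the last one.

The group H is infinite cyclic, generated by d. The homology is never presented
by generators and relations. Instead, an explicit integral cochain is shown to
span the rational cohomology ([integer_cover]): any rational cochain that kills
the boundaries has a potential on the corners of the tetrahedra
([corner_potential]), and the equations satisfied by this potential across the
faces of V_k are the relations above. *)

(** * Cochains on the dual complex and rational homology *)

Lemma common_denominator (I : finType) (d : I -> rat) :
  exists2 m : nat, (0 < m)%N & exists z : I -> int, forall i, d i * m%:R = (z i)%:~R.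
Proof.
pose m := (\prod_i `|denq (d i)|)%N.
exists m; first by apply: prodn_gt0 => i; rewrite absz_gt0 denq_neq0.
exists (fun i => numq (d i) * (\prod_(j | j != i) `|denq (d j)|)%N%:Z) => i.
by rewrite /m (bigD1 i) //= natrM mulrA intrM numqE -(absz_denq (d i)).
Qed.

Lemma ord4P (P : 'I_4 -> Prop) : P 0 -> P 1 -> P 2 -> P 3 -> forall i, P i.
Proof.
move=> P0 P1 P2 P3 [[|[|[|[|//]]]] lt_i].
- by have -> : Ordinal lt_i = 0 by exact: val_inj.
- by have -> : Ordinal lt_i = 1 by exact: val_inj.
- by have -> : Ordinal lt_i = 2 by exact: val_inj.
- by have -> : Ordinal lt_i = 3 by exact: val_inj.
Qed.

(** On each orbit, [phi] is minus the sum of [u] from a base point on; it closes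
up because [u] sums to zero around the orbit. *)
Lemma orbit_sum_potential (X : finType) (f : X -> X) (A : zmodType) (u : X -> A) :
  injective f -> (forall x, \sum_(y <- fingraph.orbit f x) u y = 0) ->
  exists phi, forall x, phi x = u x + phi (f x).
Proof.
move=> injf sum0; pose S r k := \sum_(i < k) u (iter i f r).
have sum_order r : S r (fingraph.order f r) = 0.
  rewrite -[RHS](sum0 r) /S /fingraph.orbit.
  rewrite (big_nth r) size_traject big_mkord.
  by apply: eq_bigr => i _; rewrite nth_traject.
pose r x := fingraph.froot f x.
exists (fun x => - S (r x) (findex f (r x) x)) => x.
have rx : fconnect f (r x) x.
  by rewrite (fconnect_sym injf) connect_root.
have -> : r (f x) = r x.
  by apply/esym/(fingraph.rootP (fconnect_sym injf)); exact: fconnect1.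
have := findex_max rx; have := iter_findex rx.
set k := findex f (r x) x => xE.
have fx : f x = iter k.+1 f (r x) by rewrite iterS xE.
rewrite leq_eqVlt => /orP [/eqP k_max|k_lt].
  have -> : f x = r x by rewrite fx k_max (fingraph.iter_order injf).
  rewrite findex0 {2}/S big_ord0 oppr0 addr0; apply/eqP.
  rewrite eq_sym -addr_eq0 addrC; apply/eqP.
  have := sum_order (r x); rewrite -k_max /S big_ord_recr /= -/(S _ _).
  by rewrite xE.
rewrite fx findex_iter // {2}/S big_ord_recr /= xE -/(S _ _).
by rewrite opprD addrCA subrr addr0.
Qed.

Section Homology.
Variables (T : finType) (tri : triangulation T).
Implicit Types (c : chain1 T) (h : T * 'I_4) (x y : T * 'S_4).

Definition boundary_gen (g : (T * 'I_4) + (T * 'S_4)) : chain1 T :=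
  match g with
  | inl h => dual_edge h + dual_edge (flip tri h)
  | inr x => cell_boundary tri x
  end.

Section ChainEval.
Variables (A : zmodType) (f : T * 'I_4 -> A).

Lemma chain_evalD c1 c2 : chain_eval f (c1 + c2) = chain_eval f c1 + chain_eval f c2.
Proof.
by rewrite /chain_eval -big_split; apply: eq_bigr => h _; rewrite ffunE mulrzDr.
Qed.

Lemma chain_eval0 : chain_eval f 0 = 0.
Proof. by rewrite /chain_eval big1 // => h _; rewrite ffunE mulr0z. Qed.

Lemma chain_eval_sum (I : finType) (F : I -> chain1 T) :
  chain_eval f (\sum_i F i) = \sum_i chain_eval f (F i).
Proof. exact: (big_morph _ chain_evalD chain_eval0). Qed.

Lemma chain_evalMz c z : chain_eval f (c *~ z) = chain_eval f c *~ z.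
Proof.
rewrite /chain_eval mulrz_suml; apply: eq_bigr => h _.
by rewrite ffunMzE mulrzz mulrzA.
Qed.

Lemma chain_evalB c1 c2 : chain_eval f (c1 - c2) = chain_eval f c1 - chain_eval f c2.
Proof. by rewrite chain_evalD -(mulrN1z c2) chain_evalMz mulrN1z. Qed.

Lemma chain_eval_dual_edge h : chain_eval f (dual_edge h) = f h.
Proof.
rewrite /chain_eval (bigD1 h) //= ffunE eqxx mulr1z big1 ?addr0 // => h' /negPf neq.
by rewrite ffunE neq mulr0z.
Qed.

Lemma chain_eval_cell x : chain_eval f (cell_boundary tri x) =
  \sum_(y <- fingraph.orbit (turn tri) x) f (y.1, y.2 2).
Proof.
rewrite /cell_boundary (big_morph _ chain_evalD chain_eval0).
by apply: eq_bigr => y _; exact: chain_eval_dual_edge.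
Qed.
End ChainEval.

(** A vector outside the row space of a matrix is detected by a column of its
cokernel; such a column is a cochain that kills the boundaries. Denominators are
cleared in the rational combination obtained in the other case. *)
Lemma rational_boundary c :
  (forall psi : T * 'I_4 -> rat,
     (forall g, chain_eval psi (boundary_gen g) = 0) -> chain_eval psi c = 0) ->
  exists2 m, (0 < m)%N & is_boundary tri (c *+ m).
Proof.
move=> dual_c.
pose I : finType := ((T * 'I_4) + (T * 'S_4))%type.
pose J : finType := (T * 'I_4)%type.
pose row_of c : 'rV[rat]_#|J| := \row_j (c (enum_val j))%:~R.
pose A : 'M[rat]_(#|I|, #|J|) := \matrix_(i < #|I|) row_of (boundary_gen (enum_val i)).
have row_coker c' l : (row_of c' *m cokermx A) 0 l
    = chain_eval (fun h => cokermx A (enum_rank h) l) c'.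
  rewrite mxE /chain_eval (reindex (@enum_val J predT)) /=; last first.
    exact: onW_bij (enum_val_bij _).
  by apply: eq_bigr => j _; rewrite mxE enum_valK mulrC mulrzr.
have /submxP [D def_c] : (row_of c <= A)%MS.
  rewrite submxE; apply/eqP/rowP => l; rewrite row_coker mxE; apply: dual_c => g.
  have := mulmx_coker A => /(congr1 (fun M => row (enum_rank g) M)).
  rewrite row_mul rowK enum_rankK => /rowP/(_ l).
  by rewrite row_coker mxE mxE.
have [m m_gt0 [z zE]] := common_denominator (fun i => D 0 (enum_rank i)).
exists m => //; exists (fun h => z (inl h)), (fun x => z (inr x)).
apply/ffunP => h; apply: (@intr_inj rat).
have /rowP/(_ (enum_rank h)) := def_c.
rewrite !mxE enum_rankK => c_h.
have -> : \sum_h (dual_edge h + dual_edge (flip tri h)) *~ z (inl h)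
    + \sum_x cell_boundary tri x *~ z (inr x) = \sum_g boundary_gen g *~ z g.
  by rewrite big_sumType.
rewrite sum_ffunE rmorph_sum /= ffunMnE -mulr_natr rmorphM /= natz c_h.
rewrite mulr_suml (reindex (@enum_rank I)) /=; last exact: onW_bij (enum_rank_bij _).
apply: eq_bigr => g _; rewrite !mxE !enum_rankK.
have -> : ((boundary_gen g *~ z g) h)%:~R = (boundary_gen g h)%:~R * (z g)%:~R :> rat.
  by rewrite ffunMzE mulrzz intrM.
by rewrite -zE mulrAC mulrC.
Qed.

Lemma turn_inj : injective (turn tri).
Proof.
move=> [t s] [t' s'] [/= eq_t eq_s].
have eq_i : (glue tri t (s 2)).2 (s 2) = (glue tri t' (s' 2)).2 (s' 2).
  by have := congr1 (fun s : 'S_4 => s 3) eq_s; rewrite !permM tpermR.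
have := glueK tri t (s 2); rewrite eq_t eq_i glueK => -[eq_tt /invg_inj eq_g].
by move: eq_s; rewrite eq_g eq_tt => /mulIg/mulgI ->.
Qed.

Definition corner_step t (p : {set 'I_4}) i : T * {set 'I_4} :=
  ((glue tri t i).1, [set (glue tri t i).2 v | v in p]).

(** A potential witnesses that the cochain [f] sums to zero around the 2-cells:
the corners of a 2-cell are its vertices, and [f] is the difference of the
values of [kappa] along its sides. *)
Definition is_potential (A : zmodType) (f : T * 'I_4 -> A) (kappa : T -> {set 'I_4} -> A) :=
  forall t (p : {set 'I_4}) i, #|p| = 2%N -> i \notin p ->
    kappa t p = f (t, i) + kappa (corner_step t p i).1 (corner_step t p i).2.

Lemma cell_eval_potential (A : zmodType) (f : T * 'I_4 -> A) kappa x :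
  is_potential f kappa ->
  \sum_(y <- fingraph.orbit (turn tri) x) f (y.1, y.2 2) = 0.
Proof.
move=> kappaP; pose phi (y : T * 'S_4) := kappa y.1 [set y.2 0; y.2 1].
have phiP y : f (y.1, y.2 2) = phi y - phi (turn tri y).
  rewrite {1}/phi (kappaP _ _ (y.2 2)); last 2 first.
  - by rewrite cards2 (inj_eq perm_inj).
  - by rewrite !inE !(inj_eq perm_inj).
  by rewrite /phi /turn /= imsetU1 imset_set1 !permM !tpermD // addrK.
rewrite (eq_bigr _ (fun y _ => phiP y)) sumrB -(big_map (turn tri) xpredT phi).
apply/eqP; rewrite subr_eq0; apply/eqP/perm_big/uniq_perm.
- exact: fingraph.orbit_uniq.
- by rewrite (map_inj_uniq turn_inj) fingraph.orbit_uniq.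
move=> y; rewrite -fingraph.fconnect_orbit; apply/idP/mapP => [xy|[z]].
  exists (fingraph.finv (turn tri) y); last by rewrite (fingraph.f_finv turn_inj).
  by rewrite -fingraph.fconnect_orbit (connect_trans xy) // fingraph.fconnect_finv.
rewrite -fingraph.fconnect_orbit => xz ->.
exact: connect_trans xz (fconnect1 _ _).
Qed.

Lemma exists_flag (p : {set 'I_4}) : #|p| = 2%N -> exists s : 'S_4, [set s 0; s 1] == p.
Proof.
move=> /eqP/cards2P [a] [b] [neq_ab ->].
pose b' := tperm 0 a b.
have b'0 : b' != 0 by rewrite -(tpermR 0 a) (inj_eq perm_inj) eq_sym.
exists (tperm 1%R b' * tperm 0%R a)%g.
have fix0 : tperm 1 b' 0 = 0 by rewrite tpermD // eq_sym.
by rewrite !permM fix0 !tpermL /b' tpermK.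
Qed.

(** The vanishing of the sums around the 2-cells gives a potential on the flags
of [turn] only. Summing it over the flags of a corner makes it independent of
the orders of the end points and of the faces. One of the two directions of
turning sees the side of the 2-cell reversed, which is harmless as [psi] is
odd. *)
Lemma corner_potential (psi : T * 'I_4 -> rat) :
  (forall h, psi (flip tri h) = - psi h) ->
  (forall x, \sum_(y <- fingraph.orbit (turn tri) x) psi (y.1, y.2 2) = 0) ->
  exists kappa, is_potential psi kappa.
Proof.
move=> psi_flip psi_cell.
have [phi phiP] := orbit_sum_potential turn_inj psi_cell.
(* Reversing both orders of a flag reverses the direction of turning. *)
pose rho (s : 'S_4) := (tperm 0%R 1%R * tperm 2%R 3%R * s)%g.
pose next t (s : 'S_4) i := (tperm 2%R 3%R * s * (glue tri t i).2)%g.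
pose phi2 t s := phi (t, s) + phi (t, rho s).
have tC : (tperm 2%R 3%R * tperm 0%R 1%R = tperm 0%R 1%R * tperm 2%R 3%R :> 'S_4)%g.
  by apply/permP; elim/ord4P; rewrite !permM !permE.
have rhoK s : rho (rho s) = s.
  by rewrite /rho -!mulgA (mulgA (tperm 2 3)) tC -mulgA !tpermKg.
have phi2_rho t s : phi2 t (rho s) = phi2 t s by rewrite /phi2 rhoK addrC.
have exit2 t s : phi2 t s = psi (t, s 2) *+ 2 + phi2 (glue tri t (s 2)).1 (next t s (s 2)).
  rewrite /phi2 (phiP (t, s)) /turn /= -/(next _ _ _).
  rewrite (phiP (_, rho (next _ _ _))) /turn /=.
  have -> : rho (next t s (s 2)) 2 = (glue tri t (s 2)).2 (s 2).
    by rewrite /rho /next !permM [tperm 0 1 2]tpermD // tpermL tpermR.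
  rewrite glueK /= (psi_flip (t, s 2)).
  have -> : (tperm 2%R 3%R * rho (next t s (s 2)) * (glue tri t (s 2)).2^-1 = rho s)%g.
    by rewrite /rho /next !mulgA mulgK tC -!mulgA !tpermKg.
  by ring.
have exit (t : T) (s : 'S_4) (i : 'I_4) : i \notin [set s 0; s 1] ->
    phi2 t s = psi (t, i) *+ 2 + phi2 (glue tri t i).1 (next t s i).
  rewrite -(permKV s i) !inE !(inj_eq perm_inj); move: (s^-1%g i).
  elim/ord4P => // _.
  have -> : s 3 = rho s 2 by rewrite /rho !permM [tperm 0 1 2]tpermD // tpermL.
  rewrite -[LHS]phi2_rho exit2; congr (_ + _); rewrite -[RHS]phi2_rho; congr phi2.
  by rewrite /next /rho !mulgA tC -(mulgA (tperm 0 1)) !tperm2 mulg1.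
(* [next t ^~ i] maps the flags of a corner onto those of the next one. *)
pose F (p : {set 'I_4}) (s : 'S_4) := [set s 0; s 1] == p.
pose N p : rat := \sum_(s | F p s) 1.
have sum_next (t : T) (i : 'I_4) (p : {set 'I_4}) (G : 'S_4 -> rat) :
    \sum_(s | F (corner_step t p i).2 s) G s = \sum_(s | F p s) G (next t s i).
  rewrite (reindex_inj (h := next t ^~ i)) /=; last first.
    by move=> s s' /mulIg/mulgI.
  apply: eq_bigl => s; rewrite /F /next !permM !tpermD //.
  by rewrite -(imset_set1 (glue tri t i).2 (s 1)) -imsetU1 (inj_eq (imset_inj perm_inj)).
exists (fun t p => (\sum_(s | F p s) phi2 t s) / (2 * N p)) => t p i card_p nip.
rewrite /N !sum_next.
have N_neq0 : N p != 0.
  rewrite /N sumr_const pnatr_eq0 -lt0n; apply/card_gt0P.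
  by have [s sp] := exists_flag card_p; exists s.
have -> : \sum_(s | F p s) phi2 t s
    = psi (t, i) * (2 * N p) + \sum_(s | F p s) phi2 (glue tri t i).1 (next t s i).
  rewrite mulrA mulr_sumr -big_split; apply: eq_bigr => s /eqP sp.
  by rewrite (exit t s i) ?sp // mulr1 mulr_natr.
by rewrite -/(N p); field.
Qed.

Lemma chain_eval_boundary (A : zmodType) (f : T * 'I_4 -> A) kappa c :
  (forall h, f (flip tri h) = - f h) -> is_potential f kappa ->
  is_boundary tri c -> chain_eval f c = 0.
Proof.
move=> f_flip kappaP [a [b ->]]; rewrite chain_evalD !chain_eval_sum.
rewrite !big1 ?addr0 // => [x|h] _; rewrite chain_evalMz.
  by rewrite chain_eval_cell (cell_eval_potential _ kappaP) mul0rz.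
by rewrite chain_evalD !chain_eval_dual_edge f_flip subrr mul0rz.
Qed.

Lemma chain_eval_gauge (A : zmodType) (g : T -> A) c : is_cycle tri c ->
  chain_eval (fun h => g (flip tri h).1 - g h.1) c = 0.
Proof.
move=> cyc_c.
have sum_at (src : T * 'I_4 -> T) :
    \sum_h g (src h) *~ c h = \sum_t g t *~ (\sum_(h | src h == t) c h).
  rewrite (partition_big src xpredT) //=; apply: eq_bigr => t _.
  by rewrite mulrz_sumr; apply: eq_bigr => h /eqP ->.
rewrite /chain_eval; under eq_bigr do rewrite mulrzBl.
rewrite sumrB (sum_at (fun h => (flip tri h).1)) (sum_at fst) -sumrB.
by rewrite big1 // => t _; rewrite cyc_c subrr.
Qed.

Lemma parallel_edges_cycle (h h' : T * 'I_4) :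
  h.1 = h'.1 -> (flip tri h).1 = (flip tri h').1 ->
  is_cycle tri (dual_edge h - dual_edge h').
Proof.
move=> eq_src eq_tgt t.
have sum_dual (P : pred (T * 'I_4)) h0 : \sum_(h1 | P h1) dual_edge h0 h1 = (P h0)%:Z.
  rewrite big_mkcond (bigD1 h0) //= big1 ?addr0 => [|h1 /negPf neq].
    by rewrite ffunE eqxx; case: (P h0).
  by rewrite ffunE neq if_same.
have sumE (P : pred (T * 'I_4)) :
    \sum_(h1 | P h1) (dual_edge h - dual_edge h') h1 = (P h)%:Z - (P h')%:Z.
  by rewrite -!sum_dual -sumrB; apply: eq_bigr => h1 _; rewrite !ffunE.
by rewrite !sumE eq_src eq_tgt !subrr.
Qed.

(** A criterion for H to be infinite cyclic. The last hypothesis says that the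
class of [f] spans the rational first cohomology: a cochain with a potential is
a multiple of [f] up to a coboundary. By duality a cycle killed by [f] is then
torsion in homology. *)
Section IntegerCover.
Variables (f : T * 'I_4 -> int) (kappa : T -> {set 'I_4} -> int).
Hypothesis f_flip : forall h, f (flip tri h) = - f h.
Hypothesis kappaP : is_potential f kappa.
Hypothesis unit_cycle : exists2 c, is_cycle tri c & chain_eval f c = 1.
Hypothesis f_universal : forall (psi : T * 'I_4 -> rat) mu,
  (forall h, psi (flip tri h) = - psi h) -> is_potential psi mu ->
  exists g lam, forall h, psi h = g (flip tri h).1 - g h.1 + lam * (f h)%:~R.

Lemma integer_cover_surj z : exists2 c, is_cycle tri c & chain_eval f c = z.
Proof.
have [c cyc_c eval_c] := unit_cycle; exists (c *~ z); last first.
  by rewrite chain_evalMz eval_c intz.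
have sumE (P : pred (T * 'I_4)) : \sum_(h | P h) (c *~ z) h = (\sum_(h | P h) c h) *~ z.
  by rewrite mulrz_suml; apply: eq_bigr => h _; rewrite ffunMzE.
by move=> t; rewrite !sumE cyc_c.
Qed.

Lemma integer_cover_ker c : is_cycle tri c ->
  chain_eval f c = 0 <-> exists2 m, (0 < m)%N & is_boundary tri (c *+ m).
Proof.
move=> cyc_c; split=> [eval_c|[m m_gt0 bd_c]]; last first.
  have := chain_eval_boundary f_flip kappaP bd_c.
  rewrite pmulrn chain_evalMz => /eqP; rewrite mulrz_eq0 => /orP [/eqP m0|/eqP //].
  by rewrite -[m]/`|m%:Z|%N m0 in m_gt0.
apply: rational_boundary => psi psi_bd.
have psi_flip h : psi (flip tri h) = - psi h.
  apply/eqP; rewrite -addr_eq0 addrC.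
  by have := psi_bd (inl h); rewrite chain_evalD !chain_eval_dual_edge => ->.
have [|mu muP] := corner_potential psi_flip.
  by move=> x; rewrite -chain_eval_cell; exact: (psi_bd (inr x)).
have [g [lam psiE]] := f_universal psi_flip muP.
have -> : chain_eval psi c
    = chain_eval (fun h => g (flip tri h).1 - g h.1) c + lam * (chain_eval f c)%:~R.
  rewrite /chain_eval rmorph_sum mulr_sumr -big_split; apply: eq_bigr => h _ /=.
  by rewrite psiE mulrzDl mulrzz intrM mulrA (mulrzr _ (c h)).
by rewrite eval_c chain_eval_gauge // mulr0 addr0.
Qed.

Definition integer_cover : fab_cover tri :=
  FabCover f_flip integer_cover_surj integer_cover_ker.
End IntegerCover.
End Homology.

(** * The model tetrahedron *)

(** In every tetrahedron the faces 0 and 1 are on top and the faces 2 and 3 at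
the bottom; in each pair the faces are told apart by a boolean. *)
Definition tface (b : bool) : 'I_4 := if b then 1 else 0.
Definition bface (b : bool) : 'I_4 := if b then 3 else 2.
Definition is_top (i : 'I_4) : bool := (i < 2)%N.

Variant face_spec : 'I_4 -> bool -> bool -> Type :=
  | TopFace b : face_spec (tface b) true b
  | BottomFace b : face_spec (bface b) false b.

Lemma faceP (i : 'I_4) : face_spec i (is_top i) (odd i).
Proof.
case: i => [[|[|[|[|//]]]] lt_i].
- have -> : Ordinal lt_i = tface false by exact: val_inj.
  exact: (TopFace false).
- have -> : Ordinal lt_i = tface true by exact: val_inj.
  exact: (TopFace true).
- have -> : Ordinal lt_i = bface false by exact: val_inj.
  exact: (BottomFace false).
- have -> : Ordinal lt_i = bface true by exact: val_inj.
  exact: (BottomFace true).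
Qed.

Lemma odd_tface b : odd (tface b) = b. Proof. by case: b. Qed.
Lemma odd_bface b : odd (bface b) = b. Proof. by case: b. Qed.
Lemma is_top_tface b : is_top (tface b). Proof. by case: b. Qed.
Lemma is_top_bface b : is_top (bface b) = false. Proof. by case: b. Qed.
Definition faceE := (odd_tface, odd_bface, is_top_tface, is_top_bface).

(** The veering condition forces the colours of the equatorial edges. The boolean
is that of the top face containing the edge. *)
Inductive edge := Top | Bot | Red of bool | Blue of bool.

Definition ends (e : edge) : {set 'I_4} :=
  match e with
  | Top => [set 2; 3]
  | Bot => [set 0; 1]
  | Red b => if b then [set 0; 2] else [set 1; 3]
  | Blue b => if b then [set 0; 3] else [set 1; 2]
  end.

Definition edge_of_ends (p : {set 'I_4}) : edge :=
  if 0 \in p then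
    if 1 \in p then Bot else if 2 \in p then Red true else Blue true
  else if 1 \in p then
    if 2 \in p then Blue false else Red false
  else Top.

Lemma endsK : cancel ends edge_of_ends.
Proof. by case=> [||[]|[]]; rewrite /edge_of_ends !inE. Qed.

Lemma card_ends e : #|ends e| = 2%N.
Proof. by case: e => [||[]|[]]; rewrite /= cards2. Qed.

Lemma edge_of_endsK (p : {set 'I_4}) : #|p| = 2%N -> ends (edge_of_ends p) = p.
Proof.
move=> /eqP/cards2P [i] [j] [neq_ij ->]; move: i j neq_ij.
by elim/ord4P; elim/ord4P => //= _; rewrite /edge_of_ends !inE /= // setUC.
Qed.

(** Orientation and colours leave only one way to glue a top face to a bottom
face. Of the three edges of a face, two have the colour of its diagonal; the
third ones must match, and then the gluing exchanges the diagonals with the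
other two edges. The half turn is a symmetry of the model, which reduces the
four pairs of faces to the gluing of face 0 to face 3. The boolean [c] tells
whether the top diagonal of the lower tetrahedron is red. *)
Definition half_turn : 'S_4 := (tperm 0%R 1%R * tperm 2%R 3%R)%g.
Definition glue_base (c : bool) : 'S_4 :=
  if c then tperm 0 3 else (tperm 0%R 1%R * tperm 1%R 2%R * tperm 2%R 3%R)%g.
Definition glue_perm (b b' c : bool) : 'S_4 :=
  (half_turn ^+ b * glue_base c * half_turn ^+ (~~ b'))%g.

Lemma glue_perm_face b b' c : glue_perm b b' c (tface b) = bface b'.
Proof.
by case: b b' c => [] [] []; rewrite !permM /= ?perm1 !permE.
Qed.

Lemma odd_glue_perm b b' c : odd_perm (glue_perm b b' c).
Proof.
by case: b b' c => [] [] []; rewrite !odd_permM ?odd_perm1 ?odd_tperm.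
Qed.

Definition in_tface (e : edge) (b : bool) : bool :=
  match e with Top => true | Bot => false | Red b' | Blue b' => b' == b end.

Lemma in_tfaceE e b : (tface b \notin ends e) = in_tface e b.
Proof. by case: e => [||[]|[]]; case: b; rewrite !inE. Qed.

(** The edge of the upper tetrahedron to which an edge of a top face is glued,
the bottom face being [b']. The value at [Bot], which lies in no top face, is a
default. *)
Definition cross (c b' : bool) (e : edge) : edge :=
  match e with
  | Top => if c then Red b' else Blue (~~ b')
  | Bot => Bot
  | Red _ => if c then Bot else Red b'
  | Blue _ => if c then Blue (~~ b') else Bot
  end.

Definition in_bface (e : edge) (b : bool) : bool :=
  match e with Top => false | Bot => true | Red b' => b' == b | Blue b' => b' != b end.

Lemma in_bfaceE e b : (bface b \notin ends e) = in_bface e b.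
Proof. by case: e => [||[]|[]]; case: b; rewrite !inE. Qed.

Lemma cross_onto b b' c e : in_bface e b' ->
  exists2 e0, in_tface e0 b & cross c b' e0 = e.
Proof.
move=> eb'; exists (match e with
  | Top => Top
  | Bot => if c then Red b else Blue b
  | Red _ => if c then Top else Red b
  | Blue _ => if c then Blue b else Top
  end); case: e c b b' eb' => [||[]|[]] [] [] [] //.
Qed.

Lemma ends_cross b b' c e : in_tface e b ->
  [set glue_perm b b' c v | v in ends e] = ends (cross c b' e).
Proof.
case: e => [||d|d] //= => [_|/eqP->|/eqP->]; case: b b' c => [] [] [];
  by rewrite imsetU1 imset_set1 !permM /= ?perm1 !permE //= setUC.
Qed.

(** * Triangulations from a pairing of top faces with bottom faces *)

(** [up] maps a top face to the bottom face glued to it, so that the boolean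
refers to a top face in its argument and to a bottom face in its value.
[top_red] and [bot_red] are the colours of the diagonals; with the pairing they
determine everything else. *)
Record veering_data (T : Type) := VeeringData {
  up : T * bool -> T * bool;
  down : T * bool -> T * bool;
  upK : cancel up down;
  downK : cancel down up;
  top_red : T -> bool;
  bot_red : T -> bool;
  up_red : forall h, bot_red (up h).1 = top_red h.1
}.

Section VeeringData.
Variables (T : finType) (D : veering_data T).
Implicit Types (t : T) (h : T * bool) (e : edge) (b : bool).

Definition gluing h : 'S_4 := glue_perm h.2 (up D h).2 (top_red D h.1).

Definition vd_glue t (i : 'I_4) : T * 'S_4 :=
  if is_top i then ((up D (t, odd i)).1, gluing (t, odd i))
  else ((down D (t, odd i)).1, (gluing (down D (t, odd i)))^-1%g).

Lemma vd_glue_top h : vd_glue h.1 (tface h.2) = ((up D h).1, gluing h).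
Proof. by case: h => t b; rewrite /vd_glue !faceE. Qed.

Lemma vd_glue_bottom h :
  vd_glue (up D h).1 (bface (up D h).2) = (h.1, (gluing h)^-1%g).
Proof. by rewrite /vd_glue !faceE -surjective_pairing upK. Qed.

Lemma gluing_tface h : gluing h (tface h.2) = bface (up D h).2.
Proof. exact: glue_perm_face. Qed.

Lemma gluingV_bface h : (gluing h)^-1%g (bface (up D h).2) = tface h.2.
Proof. by rewrite -gluing_tface permK. Qed.

Variant half_face_spec : T -> 'I_4 -> Prop :=
  | TopHalf h : half_face_spec h.1 (tface h.2)
  | BottomHalf h : half_face_spec (up D h).1 (bface (up D h).2).

Lemma half_faceP t i : half_face_spec t i.
Proof.
case: (faceP i) => b; first exact: (TopHalf (t, b)).
by have := BottomHalf (down D (t, b)); rewrite downK.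
Qed.

Lemma vd_glueK t i :
  vd_glue (vd_glue t i).1 ((vd_glue t i).2 i) = (t, ((vd_glue t i).2)^-1%g).
Proof.
case: (half_faceP t i) => h.
  by rewrite vd_glue_top gluing_tface vd_glue_bottom.
by rewrite vd_glue_bottom gluingV_bface vd_glue_top invgK.
Qed.

Lemma vd_glue_is_top t i : is_top ((vd_glue t i).2 i) = ~~ is_top i.
Proof.
case: (half_faceP t i) => h.
  by rewrite vd_glue_top gluing_tface !faceE.
by rewrite vd_glue_bottom gluingV_bface !faceE.
Qed.

Lemma vd_glue_neq t i : ((vd_glue t i).1, (vd_glue t i).2 i) <> (t, i).
Proof. by move=> [_ eq_i]; have := vd_glue_is_top t i; rewrite eq_i; case: is_top. Qed.

Lemma vd_glue_odd t i : odd_perm (vd_glue t i).2.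
Proof.
case: (half_faceP t i) => h; rewrite ?vd_glue_top ?vd_glue_bottom ?odd_permV;
  exact: odd_glue_perm.
Qed.

Definition vd_tri : triangulation T := Triangulation vd_glueK vd_glue_neq vd_glue_odd.

Definition up_corner h e : T * edge := ((up D h).1, cross (top_red D h.1) (up D h).2 e).

Lemma corner_step_up h e : in_tface e h.2 ->
  corner_step vd_tri h.1 (ends e) (tface h.2) = ((up_corner h e).1, ends (up_corner h e).2).
Proof. by move=> he; rewrite /corner_step /= vd_glue_top /= ends_cross. Qed.

Lemma corner_step_down h e : in_tface e h.2 ->
  corner_step vd_tri (up_corner h e).1 (ends (up_corner h e).2) (bface (up D h).2)
    = (h.1, ends e).
Proof.
move=> he; rewrite /corner_step /= vd_glue_bottom /= -(ends_cross _ _ he).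
rewrite -imset_comp (eq_imset (g := id)) ?imset_id // => v /=.
exact: permK.
Qed.

Variant corner_step_spec t e i (c : T * {set 'I_4}) : Prop :=
  | StepUp b of i = tface b & in_tface e b &
      c = ((up_corner (t, b) e).1, ends (up_corner (t, b) e).2)
  | StepDown h e0 of i = bface (up D h).2 & in_tface e0 h.2 &
      (t, e) = up_corner h e0 & c = (h.1, ends e0).

(** Crossing a bottom face undoes the crossing of a top face. What is defined on
the corners and behaves well when a top face is crossed upwards thus behaves
well along whole edge classes. *)
Lemma corner_stepP t e i : i \notin ends e ->
  corner_step_spec t e i (corner_step vd_tri t (ends e) i).
Proof.
case: (half_faceP t i) => h.
  rewrite in_tfaceE => he; apply: (StepUp (b := h.2)) => //.
  by rewrite corner_step_up -?surjective_pairing.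
rewrite in_bfaceE => /(cross_onto h.2 (top_red D h.1)) [e0 he0 <-].
by apply: (StepDown (h := h) (e0 := e0)); rewrite // corner_step_down.
Qed.

Section Potential.
Variables (A : zmodType) (w : T * bool -> A).

Definition half_weight (h : T * 'I_4) : A :=
  if is_top h.2 then w (h.1, odd h.2) else - w (down D (h.1, odd h.2)).

Lemma half_weight_top h : half_weight (h.1, tface h.2) = w h.
Proof. by rewrite /half_weight /= !faceE -surjective_pairing. Qed.

Lemma half_weight_bottom h : half_weight ((up D h).1, bface (up D h).2) = - w h.
Proof. by rewrite /half_weight /= !faceE -surjective_pairing upK. Qed.

Lemma half_weight_flip (x : T * 'I_4) : half_weight (flip vd_tri x) = - half_weight x.
Proof.
case: x => t i; case: (half_faceP t i) => h; rewrite /flip /=.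
  by rewrite vd_glue_top gluing_tface half_weight_bottom half_weight_top.
by rewrite vd_glue_bottom gluingV_bface half_weight_bottom half_weight_top opprK.
Qed.

Lemma potential_up (kappa : T -> edge -> A) :
  (forall h e, in_tface e h.2 ->
     kappa h.1 e = w h + kappa (up_corner h e).1 (up_corner h e).2) ->
  is_potential vd_tri half_weight (fun t p => kappa t (edge_of_ends p)).
Proof.
move=> kappaP t p i /edge_of_endsK <- nip; rewrite endsK.
case: (corner_stepP t nip) => [b -> eb ->|h e0 -> e0h te ->] /=.
  by rewrite (half_weight_top (t, b)) endsK (kappaP (t, b)).
rewrite endsK; case: te => -> ->.
by rewrite half_weight_bottom (kappaP h e0 e0h) addKr.
Qed.

End Potential.

Lemma up_potential (psi : T * 'I_4 -> rat) mu h e : is_potential vd_tri psi mu ->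
  in_tface e h.2 -> mu h.1 (ends e) = psi (h.1, tface h.2)
     + mu (up_corner h e).1 (ends (up_corner h e).2).
Proof.
move=> muP he; rewrite (muP _ _ (tface h.2)) ?card_ends ?in_tfaceE //.
by rewrite corner_step_up.
Qed.

Lemma same_edge_invariant (A : Type) (F : T -> edge -> A) (c c' : T * {set 'I_4}) :
  (forall h e, in_tface e h.2 -> F (up_corner h e).1 (up_corner h e).2 = F h.1 e) ->
  #|c.2| = 2%N -> same_edge vd_tri c c' ->
  F c.1 (edge_of_ends c.2) = F c'.1 (edge_of_ends c'.2).
Proof.
move=> F_up card_c cc'; pose Q (c1 c2 : T * {set 'I_4}) := #|c1.2| = 2%N ->
  #|c2.2| = 2%N /\ F c1.1 (edge_of_ends c1.2) = F c2.1 (edge_of_ends c2.2).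
suff: Q c c' by case.
elim: cc' {card_c} => {c c'} [[t p] c' [i]|//|c1 c2 c3 _ Q12 _ Q23 card_c1] /=.
  rewrite /Q /= => nip -> /edge_of_endsK def_p; rewrite -def_p in nip *.
  case: (corner_stepP t nip) => [b -> eb|h e0 -> e0h te].
    rewrite /corner_step => -> /=; rewrite card_ends !endsK; split=> //.
    by rewrite -(F_up (t, b)).
  rewrite /corner_step => -> /=; rewrite card_ends !endsK; split=> //.
  by case: te => -> ->; rewrite F_up.
have [card_c2 ->] := Q12 card_c1.
exact: Q23.
Qed.

End VeeringData.

(** * Edge classes and the orientation of faces *)

Section SameEdge.
Variables (T : Type) (tri : triangulation T).
Implicit Types c : T * {set 'I_4}.

Lemma edge_step_sym c c' : edge_step tri c c' -> edge_step tri c' c.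
Proof.
case: c => t p [i /= nip ->]; exists ((glue tri t i).2 i) => /=.
  by rewrite mem_imset //; exact: perm_inj.
rewrite glueK /= -imset_comp (eq_imset (g := id)) ?imset_id // => v /=.
exact: permK.
Qed.

Lemma same_edge_sym c c' : same_edge tri c c' -> same_edge tri c' c.
Proof.
elim=> {c c'} [c c' /edge_step_sym|c|c1 c2 c3 _ c21 _ c32]; first exact: rt_step.
  exact: rt_refl.
exact: rt_trans c32 c21.
Qed.

Lemma same_edge_card c c' : same_edge tri c c' -> #|c'.2| = #|c.2|.
Proof.
elim=> {c c'} [c c' [i _ ->]|//|c1 c2 c3 _ c12 _ c23] /=; last by rewrite c23.
exact/card_imset/perm_inj.
Qed.
End SameEdge.

Lemma same_edge_cover (T : finType) (tri : triangulation T) (C : fab_cover tri) c c' :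
  same_edge (cover_tri C) c c' -> same_edge tri (c.1.1, c.2) (c'.1.1, c'.2).
Proof.
elim=> {c c'} [c c' [i nip ->]|c|c1 c2 c3 _ c12 _ c23].
- by apply: rt_step; exists i.
- exact: rt_refl.
- exact: rt_trans c12 c23.
Qed.

Lemma set_is_top : [set i | is_top i] = ends Bot.
Proof. by apply/setP; elim/ord4P; rewrite !inE. Qed.

Lemma set_is_bottom : [set i | ~~ is_top i] = ends Top.
Proof. by apply/setP; elim/ord4P; rewrite !inE. Qed.

Lemma perm4_eq (s s' : 'S_4) : s 0 = s' 0 -> s 1 = s' 1 -> s 2 = s' 2 -> s = s'.
Proof.
move=> s0 s1 s2; apply/permP; elim/ord4P => //.
rewrite -(permKV s' (s 3)); congr (s' _); move: (permKV s' (s 3)).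
by elim/ord4P: (s'^-1%g (s 3)) => //; rewrite -?s0 -?s1 -?s2 => /perm_inj.
Qed.

Lemma is_topP i : is_top i -> i = tface (odd i).
Proof. by case: faceP. Qed.

Lemma is_bottomP i : ~~ is_top i -> i = bface (odd i).
Proof. by case: faceP. Qed.

(** The two solutions differ by the half turn. The other two orders of the
vertices compatible with the pair of ends have the wrong parity, which is
computed from a decomposition into transpositions. *)
Lemma ccw_top (s : 'S_4) : ~~ odd_perm s -> is_top (s 0) ->
  [set s 1; s 2] = ends Top ->
  [/\ s 1 = 2, s 2 = 3 & s 3 = 1] \/ [/\ s 1 = 3, s 2 = 2 & s 3 = 0].
Proof.
move=> even_s top_s s12.
have : s 1 \in ends Top by rewrite -s12 set21.
have : s 2 \in ends Top by rewrite -s12 set22.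
have : s 1 != s 2 by rewrite (inj_eq perm_inj).
rewrite !inE => neq12 /orP [] /eqP s2 /orP [] /eqP s1; rewrite ?s1 ?s2 // in neq12.
- have := is_topP top_s; case: (odd _) => s0.
    have def_s : s = (tperm 0%R 1%R * tperm 0%R 3%R)%g.
      by apply: perm4_eq; rewrite ?s0 ?s1 ?s2 !permM !permE.
    by right; split=> //; rewrite def_s !permM !permE.
  have def_s : s = (tperm 1%R 3%R)%g.
    by apply: perm4_eq; rewrite ?s0 ?s1 ?s2 ?permM !permE.
  by move: even_s; rewrite def_s ?odd_permM !odd_tperm.
- have := is_topP top_s; case: (odd _) => s0.
    have def_s : s = (tperm 0%R 1%R * tperm 0%R 2%R * tperm 0%R 3%R)%g.
      by apply: perm4_eq; rewrite ?s0 ?s1 ?s2 !permM !permE.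
    by move: even_s; rewrite def_s ?odd_permM !odd_tperm.
  have def_s : s = (tperm 1%R 2%R * tperm 1%R 3%R)%g.
    by apply: perm4_eq; rewrite ?s0 ?s1 ?s2 !permM !permE.
  by left; split=> //; rewrite def_s !permM !permE.
Qed.

Lemma ccw_bottom (s : 'S_4) : odd_perm s -> ~~ is_top (s 0) ->
  [set s 1; s 2] = ends Bot ->
  [/\ s 1 = 1, s 2 = 0 & s 3 = 3] \/ [/\ s 1 = 0, s 2 = 1 & s 3 = 2].
Proof.
move=> odd_s bot_s s12.
have : s 1 \in ends Bot by rewrite -s12 set21.
have : s 2 \in ends Bot by rewrite -s12 set22.
have : s 1 != s 2 by rewrite (inj_eq perm_inj).
rewrite !inE => neq12 /orP [] /eqP s2 /orP [] /eqP s1; rewrite ?s1 ?s2 // in neq12.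
- have := is_bottomP bot_s; case: (odd _) => s0.
    have def_s : s = (tperm 0%R 3%R * tperm 0%R 2%R)%g.
      by apply: perm4_eq; rewrite ?s0 ?s1 ?s2 !permM !permE.
    by move: odd_s; rewrite def_s ?odd_permM !odd_tperm.
  have def_s : s = (tperm 0%R 2%R)%g.
    by apply: perm4_eq; rewrite ?s0 ?s1 ?s2 ?permM !permE.
  by left; split=> //; rewrite def_s ?permM !permE.
- have := is_bottomP bot_s; case: (odd _) => s0.
    have def_s : s = (tperm 0%R 3%R * tperm 0%R 2%R * tperm 0%R 1%R)%g.
      by apply: perm4_eq; rewrite ?s0 ?s1 ?s2 !permM !permE.
    by right; split=> //; rewrite def_s !permM !permE.
  have def_s : s = (tperm 0%R 2%R * tperm 0%R 1%R)%g.
    by apply: perm4_eq; rewrite ?s0 ?s1 ?s2 !permM !permE.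
  by move: odd_s; rewrite def_s ?odd_permM !odd_tperm.
Qed.

(** * Veering structures, lifts and the veering matrix *)

Arguments ends : simpl never.

(** An edge of the triangulation is named after the tetrahedron just below it,
of which it is the top diagonal. *)
Section Veering.
Variables (T : finType) (D : veering_data T).
Variable lab : T -> edge -> T.
Hypothesis lab_up : forall h e, in_tface e h.2 ->
  lab (up_corner D h e).1 (up_corner D h e).2 = lab h.1 e.
Hypothesis lab_Top : forall t, lab t Top = t.
Hypothesis lab_Bot_inj : injective (lab^~ Bot).
Hypothesis lab_class : forall t e, same_edge (vd_tri D) (t, ends e) (lab t e, ends Top).

Lemma same_edge_lab t (p : {set 'I_4}) t' (p' : {set 'I_4}) : #|p| = 2%N -> #|p'| = 2%N ->
  lab t (edge_of_ends p) = lab t' (edge_of_ends p') <-> same_edge (vd_tri D) (t, p) (t', p').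
Proof.
move=> card_p card_p'; split=> [eq_lab|]; last exact: (same_edge_invariant lab_up).
rewrite -(edge_of_endsK card_p) -(edge_of_endsK card_p').
apply: rt_trans (lab_class _ _) _; rewrite eq_lab.
exact: same_edge_sym (lab_class _ _).
Qed.

Lemma vd_out_flip (h : T * 'I_4) :
  is_top (flip (vd_tri D) h).2 = ~~ is_top h.2.
Proof. exact: vd_glue_is_top. Qed.

Lemma vd_out_card (t : T) : #|[set i | is_top i]| = 2%N.
Proof. by rewrite set_is_top card_ends. Qed.

(** A corner with both faces pointing out is a top diagonal, and the label of a
top diagonal is its own tetrahedron. *)
Lemma vd_taut_bottom t (p : {set 'I_4}) : #|p| = 2%N ->
  exists! c, same_edge (vd_tri D) (t, p) c /\ (forall i, i \notin c.2 -> is_top i).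
Proof.
move=> card_p; exists (lab t (edge_of_ends p), ends Top); split.
  split=> [|i]; last by rewrite -set_is_bottom inE negbK.
  by apply/(same_edge_lab _ _ card_p (card_ends Top)); rewrite endsK lab_Top.
move=> [t' p'] [tp' /= out_p'].
have card_p' : #|p'| = 2%N by rewrite (same_edge_card tp').
have def_p' : p' = ends Top.
  apply/esym/eqP; rewrite eqEcard card_p' card_ends andbT -set_is_bottom.
  by apply/subsetP => i; rewrite inE; apply: contraNT => /out_p'.
have /(same_edge_lab _ _ card_p card_p') := tp'.
by rewrite def_p' endsK lab_Top => ->.
Qed.

(** A corner with both faces pointing in is a bottom diagonal. Distinct bottom
diagonals have distinct labels, so every label occurs as there are finitely many
tetrahedra. *)
Lemma vd_taut_top t (p : {set 'I_4}) : #|p| = 2%N ->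
  exists! c, same_edge (vd_tri D) (t, p) c /\ (forall i, i \notin c.2 -> ~~ is_top i).
Proof.
move=> card_p; have [above aboveK above_lab] := injF_bij lab_Bot_inj.
exists (above (lab t (edge_of_ends p)), ends Bot); split.
  split=> [|i]; last by rewrite -set_is_top inE.
  apply/(same_edge_lab _ _ card_p (card_ends Bot)); rewrite endsK.
  exact/esym/above_lab.
move=> [t' p'] [tp' /= out_p'].
have card_p' : #|p'| = 2%N by rewrite (same_edge_card tp').
have def_p' : p' = ends Bot.
  apply/esym/eqP; rewrite eqEcard card_p' card_ends andbT -set_is_top.
  by apply/subsetP => i; rewrite inE; apply: contraLR => /out_p'.
have /(same_edge_lab _ _ card_p card_p') := tp'.
by rewrite def_p' endsK => ->; rewrite aboveK.
Qed.

Definition vd_taut : taut_structure (vd_tri D) :=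
  @TautStructure T (vd_tri D) (fun _ => is_top) vd_out_flip vd_out_card
    vd_taut_bottom vd_taut_top.

Definition edge_red t e : bool :=
  match e with
  | Top => top_red D t
  | Bot => bot_red D t
  | Red _ => true
  | Blue _ => false
  end.

Lemma edge_red_up h e : in_tface e h.2 ->
  edge_red (up_corner D h e).1 (up_corner D h e).2 = edge_red h.1 e.
Proof.
case: e => [_|//|b _|b _]; rewrite /up_corner /=; case red_h: top_red => //=;
  by rewrite up_red red_h.
Qed.

Definition vd_red t (p : {set 'I_4}) : bool := edge_red t (edge_of_ends p).

Lemma vd_red_edge (c c' : T * {set 'I_4}) : #|c.2| = 2%N ->
  same_edge (vd_tri D) c c' -> vd_red c.1 c.2 = vd_red c'.1 c'.2.
Proof. exact: (same_edge_invariant edge_red_up). Qed.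

Lemma vd_veering_top t (s : 'S_4) : out vd_taut t (s 0) -> ccw_from_above vd_taut t s ->
  [set s 1; s 2] = top_diag vd_taut t ->
  vd_red t [set s 2; s 3] /\ ~~ vd_red t [set s 3; s 1].
Proof.
rewrite /ccw_from_above /top_diag /= set_is_bottom => top_s; rewrite top_s => /negbT even_s.
rewrite /vd_red /edge_of_ends.
by case/(ccw_top even_s top_s) => -[-> -> ->]; rewrite !inE.
Qed.

Lemma vd_veering_bottom t (s : 'S_4) :
  ~~ out vd_taut t (s 0) -> ccw_from_above vd_taut t s ->
  [set s 1; s 2] = bottom_diag vd_taut t ->
  ~~ vd_red t [set s 2; s 3] /\ vd_red t [set s 3; s 1].
Proof.
rewrite /ccw_from_above /bottom_diag /= set_is_top => bot_s.
rewrite bot_s => odd_s; rewrite /vd_red /edge_of_ends.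
by case/(ccw_bottom odd_s bot_s) => -[-> -> ->]; rewrite !inE.
Qed.

Definition vd_colour : veering_colouring vd_taut :=
  VeeringColouring vd_red_edge vd_veering_top vd_veering_bottom.
End Veering.

Section CoverCorners.
Variables (T : finType) (D : veering_data T) (C : fab_cover (vd_tri D)).
Local Notation w h := (fab_edge C (h.1, tface h.2)).
Variables (lab : T -> edge -> T) (kappa : T -> edge -> fab_grp C).
Hypothesis lab_up : forall h e, in_tface e h.2 ->
  lab (up_corner D h e).1 (up_corner D h e).2 = lab h.1 e.
Hypothesis kappa_up : forall h e, in_tface e h.2 ->
  kappa h.1 e = w h + kappa (up_corner D h e).1 (up_corner D h e).2.

(** In the cover, the corner [e] of the tetrahedron [(t, x)] lies on the
translate by [x + kappa t e] of the edge at the top of [(lab t e, 0)]. *)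
Definition lifted_to_rep t e := forall x,
  same_edge (cover_tri C) ((t, x), ends e) ((lab t e, x + kappa t e), ends Top).

Lemma cover_step_up h e x : in_tface e h.2 ->
  edge_step (cover_tri C) ((h.1, x), ends e)
    (((up_corner D h e).1, x + w h), ends (up_corner D h e).2).
Proof.
move=> he; exists (tface h.2); first by rewrite /= in_tfaceE.
by rewrite /=; have [/= <- <-] := corner_step_up D he.
Qed.

(** Both sides of the equivalence concern the same edge of the cover, so that the
property spreads along an edge class, upwards and downwards. *)
Lemma lifted_to_rep_up h e : in_tface e h.2 ->
  lifted_to_rep h.1 e <-> lifted_to_rep (up_corner D h e).1 (up_corner D h e).2.
Proof.
move=> he; split=> rep x.
  apply: rt_trans (_ : same_edge _ _ ((h.1, x - w h), ends e)) _.
    apply: same_edge_sym; apply: rt_step.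
    by have := cover_step_up (x - w h) he; rewrite subrK.
  by have := rep (x - w h); rewrite (kappa_up he) lab_up // addrA subrK.
apply: rt_trans (rt_step _ _ _ _ (cover_step_up x he)) _.
by have := rep (x + w h); rewrite lab_up // -addrA -kappa_up.
Qed.
End CoverCorners.

Section Lifts.
Variables (n : nat) (D : veering_data 'I_n).
Variable lab : 'I_n -> edge -> 'I_n.
Hypothesis lab_up : forall h e, in_tface e h.2 ->
  lab (up_corner D h e).1 (up_corner D h e).2 = lab h.1 e.
Hypothesis lab_Top : forall t, lab t Top = t.
Hypothesis lab_Bot_inj : injective (lab^~ Bot).
Hypothesis connected : tri_connected (vd_tri D).
Variables (C : fab_cover (vd_tri D)) (kappa : 'I_n -> edge -> fab_grp C).
Hypothesis lab_lift : forall t e, lifted_to_rep lab kappa t e.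

Lemma lab_class t e : same_edge (vd_tri D) (t, ends e) (lab t e, ends Top).
Proof. exact: (same_edge_cover (lab_lift t e 0)). Qed.

Definition vd_veering : veering_triangulation n :=
  VeeringTriangulation connected (vd_colour lab_up lab_Top lab_Bot_inj lab_class).

Lemma vd_edge_coordP t (p : {set 'I_4}) : #|p| = 2%N ->
  same_edge (cover_tri C) ((t, 0), p)
    (deck (kappa t (edge_of_ends p)) ((lab t (edge_of_ends p), 0), ends Top)).
Proof. by move=> /edge_of_endsK {1}<-; exact: lab_lift. Qed.

Lemma vd_edge_liftK e : lab e (edge_of_ends (ends Top)) = e.
Proof. by rewrite endsK lab_Top. Qed.

(** With the lift at height 0 of each tetrahedron, and of each edge as the top
diagonal of the tetrahedron below it, the coordinates are given by [kappa]. *)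
Definition vd_lifts : @lifts n vd_veering C :=
  @Lifts n vd_veering C (fun t p => lab t (edge_of_ends p)) (same_edge_lab lab_up lab_class)
    (fun _ => 0) (fun e => ((e, 0), ends Top)) (fun _ => card_ends Top) vd_edge_liftK
    (fun t p => kappa t (edge_of_ends p)) vd_edge_coordP.

Lemma edge_vec_eq u e u' e' : lab u e = lab u' e' -> kappa u e = kappa u' e' ->
  edge_vec vd_lifts u (ends e) = edge_vec vd_lifts u' (ends e').
Proof. by move=> eq_lab eq_kappa; rewrite /edge_vec /= !endsK eq_lab eq_kappa. Qed.

(** The two diagonals cancel, and the equatorial edges of the colour opposite to
the red top diagonal are the blue ones. *)
Lemma veering_row u : top_red D u -> lab u Bot = u -> kappa u Bot = kappa u Top ->
  row u (veering_matrix vd_lifts) = - \sum_b edge_vec vd_lifts u (ends (Blue b)).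
Proof.
move=> red_u lab_Bot kappa_Bot; rewrite rowK.
have eq_diag := edge_vec_eq (etrans lab_Bot (esym (lab_Top u))) kappa_Bot.
have -> : bottom_diag (vt_taut vd_veering) u = ends Bot by exact: set_is_top.
have -> : top_diag (vt_taut vd_veering) u = ends Top by exact: set_is_bottom.
rewrite eq_diag opprD addNKr; congr (- _).
transitivity (\sum_(p in [set ends (Blue true); ends (Blue false)]) edge_vec vd_lifts u p);
    last first.
  by rewrite big_setU1 ?big_set1 ?big_bool // inE; apply/eqP => /(can_inj endsK).
apply: eq_bigl => p; rewrite /equatorial /= /vd_red endsK /= red_u.
rewrite /bottom_diag /top_diag /= set_is_top set_is_bottom.
apply/idP/idP => [/andP [/and3P [/eqP/edge_of_endsK <- nTop nBot]]|].
  rewrite endsK; case: (edge_of_ends p) nTop nBot => [||//|[]] //; rewrite ?eqxx //;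
    by rewrite !inE eqxx ?orbT.
rewrite !inE => /orP [] /eqP ->; rewrite endsK card_ends eqxx /= andbT;
  by apply/andP; split; apply/eqP => /(can_inj endsK).
Qed.

Lemma veering_polynomial_twin_rows t t' : t != t' ->
  (forall u, u \in [:: t; t'] ->
     [/\ top_red D u, lab u Bot = u & kappa u Bot = kappa u Top]) ->
  (forall b, lab t (Blue b) = lab t' (Blue b) /\ kappa t (Blue b) = kappa t' (Blue b)) ->
  veering_polynomial vd_lifts = 0.
Proof.
move=> neq_tt' flat blue_tt'.
apply: (determinant_alternate neq_tt') => j.
have [|red_t lab_t kappa_t] := flat t; first by rewrite mem_head.
have [|red_t' lab_t' kappa_t'] := flat t'; first by rewrite !inE eqxx orbT.
have eq_blue b : edge_vec vd_lifts t (ends (Blue b)) = edge_vec vd_lifts t' (ends (Blue b)).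
  by have [eq_lab eq_kappa] := blue_tt' b; exact: edge_vec_eq.
have eq_sum := eq_bigr _ (fun b _ => eq_blue b) :
  \sum_b edge_vec vd_lifts t (ends (Blue b)) = \sum_b edge_vec vd_lifts t' (ends (Blue b)).
have := etrans (veering_row red_t lab_t kappa_t)
  (etrans (congr1 -%R eq_sum) (esym (veering_row red_t' lab_t' kappa_t'))).
by move=> /rowP/(_ j); rewrite [LHS]mxE [RHS]mxE.
Qed.
End Lifts.

(** * The triangulations of the family *)

(** The pieces are indexed by all the natural numbers, so that the gluings are
computed by pattern matching; [valid] bounds the indices, and [enc] and [dec]
number the valid pieces. *)
Inductive tetra := Slab of nat | Cap | Rung of nat.

Section Family.
Variable k : nat.
Let m := k.+1.
Local Notation T := 'I_(8 + k).

Definition valid (x : tetra) : bool :=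
  match x with Slab i => (i < 5)%N | Cap => true | Rung j => (j <= m)%N end.

Definition number (x : tetra) : nat :=
  match x with Slab i => i | Cap => 5%N | Rung j => (6 + j)%N end.

Definition enc (x : tetra) : T := inord (number x).

Definition dec (t : T) : tetra :=
  if (t < 5)%N then Slab t else if t == 5%N :> nat then Cap else Rung (t - 6).

Lemma encK x : valid x -> dec (enc x) = x.
Proof.
move=> x_ok; have lt_x : (number x < 8 + k)%N by case: x x_ok => //= i; lia.
rewrite /dec /enc inordK //; case: x x_ok {lt_x} => //= i; first by move=> ->.
by move=> _; congr Rung; lia.
Qed.

Lemma decK : cancel dec enc.
Proof.
move=> t; apply: val_inj; rewrite /= /enc /dec.
case: ifP => [lt5|ge5]; first by rewrite inordK //=; lia.
have lt_t := ltn_ord t.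
by case: eqP => [t5|ne5]; rewrite inordK /=; lia.
Qed.

Lemma dec_valid t : valid (dec t).
Proof.
have lt_t := ltn_ord t; rewrite /dec.
by case: ifP => //= ge5; case: eqP => //= ne5; lia.
Qed.

Lemma tetraP (P : T -> Prop) : (forall x, valid x -> P (enc x)) -> forall t, P t.
Proof. by move=> Penc t; rewrite -(decK t); apply/Penc/dec_valid. Qed.

(** Slab 4 carries rung [m] and the cap, which carry slab 0 in turn. A rung lies
on the previous rung and on the next one. *)
Definition above (h : tetra * bool) : tetra * bool :=
  let (x, b) := h in
  match x with
  | Slab i => if (i < 4)%N then (Slab i.+1, b)
              else if b then (Cap, false) else (Rung m, true)
  | Cap => if b then (Cap, true) else (Slab 0, true)
  | Rung j => if b then if (j < m)%N then (Rung j.+1, false) else (Slab 0, false)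
              else if j is j'.+1 then (Rung j', true) else (Rung 0, false)
  end.

Definition below (h : tetra * bool) : tetra * bool :=
  let (x, b) := h in
  match x with
  | Slab i => if i is i'.+1 then (Slab i', b)
              else if b then (Cap, false) else (Rung m, true)
  | Cap => if b then (Cap, true) else (Slab 4, true)
  | Rung j => if b then if (j < m)%N then (Rung j.+1, false) else (Slab 4, false)
              else if j is j'.+1 then (Rung j', true) else (Rung 0, false)
  end.

Lemma above_valid x b : valid x -> valid (above (x, b)).1.
Proof.
case: x => [[|[|[|[|[|//]]]]]||[|j]] //=; case: b => //=; try lia.
by case: ifP => //=; lia.
Qed.

Lemma below_valid x b : valid x -> valid (below (x, b)).1.
Proof.
case: x => [[|[|[|[|[|//]]]]]||[|j]] //=; case: b => //=; try lia.
by case: ifP => //=; lia.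
Qed.

Lemma aboveK x b : valid x -> below (above (x, b)) = (x, b).
Proof.
case: x => [[|[|[|[|[|//]]]]]||[|j]] //=; case: b => //= x_ok.
- by rewrite ltnn.
- case: ifP => [//|/negbT]; rewrite -leqNgt => le_mj /=.
  by have -> : m = j.+1 by lia.
- by rewrite x_ok.
Qed.

Lemma belowK x b : valid x -> above (below (x, b)) = (x, b).
Proof.
case: x => [[|[|[|[|[|//]]]]]||[|j]] //=; case: b => //= x_ok; rewrite ?ltnn //.
- case: ifP => [//|/negbT]; rewrite -leqNgt => le_mj /=.
  by have -> : m = j.+1 by lia.
- by rewrite x_ok.
Qed.

Definition ceiling_red (x : tetra) : bool := if x is Slab i then i == 4%N else true.
Definition floor_red (x : tetra) : bool := if x is Slab i then i == 0%N else true.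

Lemma floor_red_above x b : valid x -> floor_red (above (x, b)).1 = ceiling_red x.
Proof.
case: x => [[|[|[|[|[|//]]]]]||[|j]] //=; case: b => //= _.
by case: ifP.
Qed.

Definition up_T (h : T * bool) : T * bool :=
  (enc (above (dec h.1, h.2)).1, (above (dec h.1, h.2)).2).
Definition down_T (h : T * bool) : T * bool :=
  (enc (below (dec h.1, h.2)).1, (below (dec h.1, h.2)).2).

Lemma dec_up_T h : (dec (up_T h).1, (up_T h).2) = above (dec h.1, h.2).
Proof.
rewrite /up_T; case: (above _) (above_valid h.2 (dec_valid h.1)) => y c /= y_ok.
by rewrite encK.
Qed.

Lemma dec_down_T h : (dec (down_T h).1, (down_T h).2) = below (dec h.1, h.2).
Proof.
rewrite /down_T; case: (below _) (below_valid h.2 (dec_valid h.1)) => y c /= y_ok.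
by rewrite encK.
Qed.

Lemma up_TK : cancel up_T down_T.
Proof.
by move=> [t b]; rewrite /down_T dec_up_T aboveK ?dec_valid //= decK.
Qed.

Lemma down_TK : cancel down_T up_T.
Proof.
by move=> [t b]; rewrite /up_T dec_down_T belowK ?dec_valid //= decK.
Qed.

Lemma up_T_red h : floor_red (dec (up_T h).1) = ceiling_red (dec h.1).
Proof.
by rewrite /up_T encK ?above_valid ?dec_valid // floor_red_above ?dec_valid.
Qed.

Definition tower : veering_data T :=
  VeeringData up_TK down_TK (top_red := ceiling_red \o dec) (bot_red := floor_red \o dec) up_T_red.

Lemma up_enc x b : valid x ->
  up tower (enc x, b) = (enc (above (x, b)).1, (above (x, b)).2).
Proof. by move=> x_ok; rewrite /= /up_T /= encK. Qed.

(** The tetrahedron just below the edge [e] of [x]. The long class of [Slab 3]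
consists of the top diagonal of slab 3 and of the blue edges of slab 4, of the
cap, of slab 0 and of all the rungs, up to the bottom diagonal of slab 1. *)
Definition rep (x : tetra) (e : edge) : tetra :=
  match x, e with
  | _, Top => x
  | Slab i, Bot => match i with 0 => Slab 4 | 1 => Slab 3 | j.+2 => Slab j end
  | Slab _, Red b => if b then Cap else Rung m
  | Slab i, Blue _ => if i is j.+1 then Slab j else Slab 3
  | Cap, Bot => Cap
  | Cap, Red b => if b then Cap else Slab 4
  | Cap, Blue _ => Slab 3
  | Rung _, Bot => x
  | Rung j, Red b => if b then if (j < m)%N then Rung j.+1 else Slab 4 else Rung j.-1
  | Rung _, Blue _ => Slab 3
  end.

(** The position of the edges in the cover with deck group Z, relative to the
lifts of the edges as top diagonals at height 0. *)
Definition height (x : tetra) (e : edge) : int :=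
  match x, e with
  | _, Top => 0
  | Slab i, Bot => match i with 0 => 0 | 1 => - 2 | _ => - 1 end
  | Slab i, Red b => if b then - i%:Z else 0
  | Slab i, Blue b => if b then if i is 0 then - 1 else 0 else if i is 0 then - 2 else - 1
  | Cap, Bot => - 4
  | Cap, Red b => if b then - 2 else 0
  | Cap, Blue b => if b then 0 else - 2
  | Rung _, Bot => 0
  | Rung _, Red _ => 0
  | Rung _, Blue _ => - 1
  end.

(** The cochain that generates the first cohomology. It takes the value 1 on the
generator d and 2 on the loop around the cap, and vanishes on the ladder. *)
Definition rise (h : tetra * bool) : int :=
  let (x, b) := h in
  match x with
  | Slab i => if b && (i < 4)%N then 1 else 0
  | Cap => if b then 2 else 0
  | Rung _ => 0
  end.

Definition crossing (x : tetra) (b : bool) (e : edge) : tetra * edge :=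
  ((above (x, b)).1, cross (ceiling_red x) (above (x, b)).2 e).

Lemma rep_valid x e : valid x -> valid (rep x e).
Proof.
case: x e => [[|[|[|[|[|//]]]]]||j] [||[]|[]] //=; rewrite -?/m ?leqnn //; first by case: ifP.
lia.
Qed.

Lemma rep_crossing x b e : valid x -> in_tface e b ->
  rep (crossing x b e).1 (crossing x b e).2 = rep x e.
Proof.
rewrite /crossing.
case: x => [[|[|[|[|[|//]]]]]||[|j]] //= x_ok; case: b; case: e => [||[]|[]] //= _;
  rewrite ?ltnn ?x_ok //; case: ifP => //= /negbT; rewrite -leqNgt => le_mj;
  by have -> : m = j.+1 by lia.
Qed.

Lemma height_crossing x b e : valid x -> in_tface e b ->
  height x e = rise (x, b) + height (crossing x b e).1 (crossing x b e).2.
Proof.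
rewrite /crossing.
case: x => [[|[|[|[|[|//]]]]]||[|j]] //= x_ok; case: b; case: e => [||[]|[]] //= _;
  by case: ifP.
Qed.

Lemma rep_Bot_inj x y : valid x -> valid y -> rep x Bot = rep y Bot -> x = y.
Proof.
by case: x => [[|[|[|[|[|//]]]]]||j]; case: y => [[|[|[|[|[|//]]]]]||j'].
Qed.

Definition rep_T (t : T) e : T := enc (rep (dec t) e).
Definition height_T (t : T) e : int := height (dec t) e.
Definition rise_T (h : T * bool) : int := rise (dec h.1, h.2).

Lemma dec_up_corner h e :
  dec (up_corner tower h e).1 = (crossing (dec h.1) h.2 e).1 /\
  (up_corner tower h e).2 = (crossing (dec h.1) h.2 e).2.
Proof. by rewrite /up_corner /crossing -dec_up_T. Qed.

Lemma rep_T_up h e : in_tface e h.2 ->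
  rep_T (up_corner tower h e).1 (up_corner tower h e).2 = rep_T h.1 e.
Proof.
move=> he; have [dec1 dec2] := dec_up_corner h e.
by rewrite /rep_T dec1 dec2 rep_crossing ?dec_valid.
Qed.

Lemma height_T_up h e : in_tface e h.2 -> height_T h.1 e
  = rise_T h + height_T (up_corner tower h e).1 (up_corner tower h e).2.
Proof.
move=> he; have [dec1 dec2] := dec_up_corner h e.
by rewrite /height_T dec1 dec2; apply: height_crossing; rewrite ?dec_valid.
Qed.

Lemma rep_T_Top t : rep_T t Top = t.
Proof. by rewrite /rep_T; case: (dec t) (decK t). Qed.

Lemma rep_T_Bot_inj : injective (rep_T^~ Bot).
Proof.
move=> t t' /(congr1 dec); rewrite !encK ?rep_valid ?dec_valid //.
by move=> /(rep_Bot_inj (dec_valid t) (dec_valid t')) /(can_inj decK).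
Qed.

Lemma tower_unit_cycle : exists2 c, is_cycle (vd_tri tower) c
  & chain_eval (half_weight tower rise_T) c = 1.
Proof.
pose h b := (enc (Slab 0), tface b).
have h_tgt b : (flip (vd_tri tower) (h b)).1 = enc (Slab 1).
  by rewrite /flip /= (vd_glue_top tower (enc (Slab 0), b)) up_enc.
exists (dual_edge (h true) - dual_edge (h false)).
  by apply: parallel_edges_cycle; rewrite ?h_tgt.
rewrite chain_evalB !chain_eval_dual_edge.
by rewrite !(half_weight_top tower rise_T (_, _)) /rise_T encK.
Qed.

(** * The homology and the veering polynomial of the family *)

(** The values [p] of a rational cochain on the dual edges are constrained by the
existence of a potential [mu], one equation for each edge of each top face. Each
edge class gives a relation: the class of [Slab 3] the value of the cap loop in
[long_edge], those of [Cap], [Rung m] and [Slab 4] the total value of the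
vertical loops. Together they kill the self-gluing loop [a] of the ladder, and
what remains is proportional to [rise] after a change of gauge. *)
Lemma potential_gauge (p : tetra -> bool -> rat) (mu : tetra -> edge -> rat) :
  (forall x b e, valid x -> in_tface e b ->
     mu x e = p x b + mu (crossing x b e).1 (crossing x b e).2) ->
  exists g lam, forall x b, valid x ->
    p x b = g (above (x, b)).1 - g x + lam * (rise (x, b))%:~R.
Proof.
move=> muE; pose a := p (Rung 0) false.
pose lam := p (Slab 0) true - p (Slab 0) false.
have slab_step i : (i < 4)%N -> p (Slab i) true = p (Slab i) false + lam.
  have diff j : (j < 3)%N ->
      p (Slab j) true - p (Slab j) false = p (Slab j.+1) true - p (Slab j.+1) false.
    case: j => [|[|[|//]]] _.
    - have := muE (Slab 0) false Top isT isT; have := muE (Slab 0) true Top isT isT.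
      have := muE (Slab 1) false (Blue false) isT isT.
      have := muE (Slab 1) true (Blue true) isT isT.
      by rewrite /crossing /=; lra.
    - have := muE (Slab 1) false Top isT isT; have := muE (Slab 1) true Top isT isT.
      have := muE (Slab 2) false (Blue false) isT isT.
      have := muE (Slab 2) true (Blue true) isT isT.
      by rewrite /crossing /=; lra.
    have := muE (Slab 2) false Top isT isT; have := muE (Slab 2) true Top isT isT.
    have := muE (Slab 3) false (Blue false) isT isT.
    have := muE (Slab 3) true (Blue true) isT isT.
    by rewrite /crossing /=; lra.
  elim: i => [|i IHi] lt_i; first by rewrite /lam addrC subrK.
  by have := diff i lt_i; have := IHi (ltnW lt_i); lra.
have rung_pair j : (j < m)%N -> p (Rung j) true + p (Rung j.+1) false = 2 * a.
  elim: j => [|j IHj] lt_jm.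
    have := muE (Rung 0) false Top isT isT; have := muE (Rung 0) true Top isT isT.
    have := muE (Rung 0) false (Red false) isT isT.
    have := muE (Rung 1) false (Red false) isT isT.
    by rewrite /crossing /= /a; lra.
  have le_jm := ltnW lt_jm.
  have := muE (Rung j.+1) false Top le_jm isT; have := muE (Rung j.+1) true Top le_jm isT.
  have := muE (Rung j) true (Red true) (ltnW le_jm) isT.
  have := muE (Rung j.+2) false (Red false) lt_jm isT.
  by have := IHj le_jm; rewrite /crossing /= lt_jm le_jm /=; lra.
(* The blue edges of the ladder form a path through the rungs j, ..., 0 and,
   after the self-gluing of rung 0, back to rung j. *)
have rung_blue j : (j <= m)%N ->
    mu (Rung j) (Blue false) = mu (Rung j) (Blue true) + (2 * j%:R + 1) * a.
  elim: j => [_|j IHj lt_jm].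
    by have := muE (Rung 0) false (Blue false) isT isT; rewrite /crossing /= /a; lra.
  have := muE (Rung j.+1) false (Blue false) lt_jm isT.
  have := muE (Rung j) true (Blue true) (ltnW lt_jm) isT.
  rewrite -natr1; have := IHj (ltnW lt_jm); have := rung_pair j lt_jm.
  by rewrite /crossing /= lt_jm /=; lra.
have long_side : p (Slab 4) false + p (Rung m) true = p (Slab 4) true + p Cap false.
  have := muE (Slab 4) false Top isT isT; have := muE (Slab 4) true Top isT isT.
  have := muE (Rung m) true (Red true) (leqnn m) isT.
  have := muE Cap false (Red false) isT isT.
  by rewrite /crossing /= ltnn /=; lra.
have long_edge : p Cap true = (2 * m%:R + 1) * a + 2 * lam.
  have := muE (Slab 3) false Top isT isT; have := muE (Slab 3) true Top isT isT.
  have := muE (Slab 4) false (Blue false) isT isT.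
  have := muE (Slab 4) true (Blue true) isT isT.
  have := muE Cap true (Blue true) isT isT; have := muE Cap false (Blue false) isT isT.
  have := muE (Slab 0) false (Blue false) isT isT.
  have := muE (Slab 0) true (Blue true) isT isT.
  have := muE (Rung m) true (Blue true) (leqnn m) isT.
  have := rung_blue m (leqnn m); have := slab_step 0%N isT; have := slab_step 3%N isT.
  by rewrite /crossing /= ltnn /=; lra.
have cap_edge : 2 * p Cap true = p Cap false + p (Slab 4) true
    + (p (Slab 0) true + p (Slab 1) true + p (Slab 2) true + p (Slab 3) true).
  have := muE Cap true Top isT isT; have := muE Cap false Top isT isT.
  have := muE Cap true (Red true) isT isT.
  have := muE (Slab 0) true (Red true) isT isT; have := muE (Slab 1) true (Red true) isT isT.
  have := muE (Slab 2) true (Red true) isT isT; have := muE (Slab 3) true (Red true) isT isT.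
  have := muE (Slab 4) true (Red true) isT isT.
  by rewrite /crossing /=; lra.
have rung_edge : 2 * a = p (Rung m) true + p (Slab 4) false
    + (p (Slab 0) false + p (Slab 1) false + p (Slab 2) false + p (Slab 3) false).
  have := muE (Rung k.+1) false Top (leqnn m) isT.
  have := muE (Rung m) true Top (leqnn m) isT.
  have := muE (Rung k) true (Red true) (leqnSn k) isT.
  have := muE (Slab 0) false (Red false) isT isT; have := muE (Slab 1) false (Red false) isT isT.
  have := muE (Slab 2) false (Red false) isT isT; have := muE (Slab 3) false (Red false) isT isT.
  have := muE (Slab 4) false (Red false) isT isT; have := rung_pair k (ltnSn k).
  by rewrite /crossing /= !ltnn (ltnSn k) /= -/m; lra.
have a0 : a = 0.
  (* Eliminating [p Cap true] between [long_edge] and [cap_edge] leaves 4 m a. *)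
  have /eqP : m%:R * a = 0.
    have := slab_step 0%N isT; have := slab_step 1%N isT.
    have := slab_step 2%N isT; have := slab_step 3%N isT; lra.
  by rewrite mulf_eq0 pnatr_eq0 => /eqP.
(* The gauge makes [p] vanish on the dual edges from slab to slab through top
   face 0, from slab 4 to the cap and to the ladder, and from each rung to the
   previous one. *)
pose ground := \sum_(l < 4) p (Slab l) false.
exists (fun x => match x with
  | Slab i => \sum_(l < i) p (Slab l) false
  | Cap => ground + p (Slab 4) true
  | Rung j => ground + p (Slab 4) false + \sum_(j <= l < m) p (Rung l.+1) false
  end), lam.
have groundE : ground
  = p (Slab 0) false + p (Slab 1) false + p (Slab 2) false + p (Slab 3) false.
  by rewrite /ground !big_ord_recr big_ord0 /= add0r.
case=> [i||j] b x_ok; rewrite /above /rise.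
- case: ifP => [lt_i4|ge_i4] /=.
    by rewrite big_ord_recr; case: b; rewrite /= ?slab_step //; ring.
  have -> : i = 4%N by move: x_ok; rewrite /=; lia.
  by rewrite -/ground; case: b => /=; rewrite ?big_geq //; ring.
- by case: b => /=; rewrite ?long_edge ?a0 ?big_ord0 ?groundE; lra.
rewrite mulr0 addr0; case: b => /=.
  case: ifP => [lt_jm|ge_jm] /=.
    have := rung_pair j lt_jm; rewrite a0 [\sum_(j <= _ < _) _]big_ltn //; lra.
  have -> : j = m by move: x_ok ge_jm; rewrite /=; lia.
  by rewrite big_ord0 big_geq // groundE; lra.
case: j x_ok => [_|j lt_jm] /=; first by rewrite subrr -/a a0.
by rewrite [\sum_(j <= _ < _) _]big_ltn //; lra.
Qed.

Lemma tower_universal (psi : T * 'I_4 -> rat) mu :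
  (forall h, psi (flip (vd_tri tower) h) = - psi h) ->
  is_potential (vd_tri tower) psi mu ->
  exists g lam, forall h, psi h
    = g (flip (vd_tri tower) h).1 - g h.1 + lam * (half_weight tower rise_T h)%:~R.
Proof.
move=> psi_flip muP.
have [|g [lam psiE]] := @potential_gauge (fun x b => psi (enc x, tface b))
  (fun x e => mu (enc x) (ends e)).
  move=> x b e x_ok eb; rewrite (up_potential (h := (enc x, b)) muP eb) /up_corner.
  by rewrite up_enc //= encK.
have psi_top h : psi (h.1, tface h.2)
    = g (dec (up tower h).1) - g (dec h.1) + lam * (rise_T h)%:~R.
  by rewrite -{1}(decK h.1) psiE ?dec_valid // -dec_up_T.
exists (fun t => g (dec t)), lam => -[t i]; case: (half_faceP tower t i) => h.
  by rewrite psi_top (half_weight_top tower) /flip /= (vd_glue_top tower).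
have -> : ((up tower h).1, bface (up tower h).2)
    = flip (vd_tri tower) (h.1, tface h.2).
  by rewrite /flip /= (vd_glue_top tower) (gluing_tface tower).
rewrite psi_flip half_weight_flip (half_weight_top tower) psi_top.
have -> : (flip (vd_tri tower) (flip (vd_tri tower) (h.1, tface h.2))).1 = h.1.
  by rewrite /flip /= vd_glueK.
have -> : (flip (vd_tri tower) (h.1, tface h.2)).1 = (up tower h).1.
  by rewrite /flip /= (vd_glue_top tower).
by rewrite mulrNz; ring.
Qed.

Definition tower_cover : fab_cover (vd_tri tower) :=
  integer_cover (half_weight_flip tower rise_T)
    (potential_up height_T_up) tower_unit_cycle tower_universal.

Local Notation lifted x e :=
  (lifted_to_rep (C := tower_cover) rep_T height_T (enc x) e).

Lemma lifted_crossing x b e : valid x -> in_tface e b ->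
  lifted x e <-> lifted (crossing x b e).1 (crossing x b e).2.
Proof.
move=> x_ok eb.
have h_up h e' : in_tface e' h.2 -> height_T h.1 e'
    = fab_edge tower_cover (h.1, tface h.2)
      + height_T (up_corner tower h e').1 (up_corner tower h e').2.
  by rewrite [fab_edge _ _](half_weight_top tower); exact: height_T_up.
have := @lifted_to_rep_up _ _ tower_cover _ _ rep_T_up h_up (enc x, b) e eb.
by rewrite /up_corner up_enc //= encK.
Qed.

Lemma lifted_Top x : valid x -> lifted x Top.
Proof.
move=> x_ok y; rewrite rep_T_Top /height_T encK //.
have -> : height x Top = 0 by case: (x).
rewrite addr0; exact: rt_refl.
Qed.

(** The edge classes are followed from their bottom corner upwards, except that
the blue edges of the rungs and one of those of slab 0 are reached downwards
from the bottom diagonal of slab 1. *)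
Lemma lifted_all t e : lifted_to_rep (C := tower_cover) rep_T height_T t e.
Proof.
have fwd x b e' : valid x -> in_tface e' b -> lifted x e' ->
    lifted (crossing x b e').1 (crossing x b e').2.
  by move=> x_ok eb; case: (lifted_crossing x_ok eb).
have bwd x b e' : valid x -> in_tface e' b ->
    lifted (crossing x b e').1 (crossing x b e').2 -> lifted x e'.
  by move=> x_ok eb; case: (lifted_crossing x_ok eb).
have slab_blue i b : (i < 4)%N -> lifted (Slab i.+1) (Blue b).
  move=> lt_i4; have ok : valid (Slab i) by rewrite /=; lia.
  have := fwd (Slab i) (~~ b) Top ok isT (lifted_Top ok).
  by rewrite /crossing /= lt_i4 ltn_eqF //= negbK.
have slab_bot i : (i < 3)%N -> lifted (Slab i.+2) Bot.
  move=> lt_i3; have ok : valid (Slab i.+1) by rewrite /=; lia.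
  have := fwd (Slab i.+1) true (Blue true) ok isT (slab_blue i true (ltnW lt_i3)).
  by rewrite /crossing /= ltnS lt_i3 eqSS ltn_eqF.
have cap_blue_t : lifted Cap (Blue true).
  exact: (fwd (Slab 4) true (Blue true) isT isT (slab_blue 3%N true isT)).
have cap_blue_f : lifted Cap (Blue false) by exact: (fwd Cap true (Blue true) isT isT).
have slab0_blue_f : lifted (Slab 0) (Blue false).
  exact: (fwd Cap false (Blue false) isT isT).
have slab1_bot : lifted (Slab 1) Bot by exact: (fwd (Slab 0) false (Blue false) isT isT).
have slab0_blue_t : lifted (Slab 0) (Blue true).
  exact: (bwd (Slab 0) true (Blue true) isT isT).
have rung_blue_t j : (j <= m)%N -> lifted (Rung j) (Blue true).
  move=> le_jm; rewrite -(subKn le_jm); have := leq_subr j m.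
  elim: (m - j)%N => [_|i IHi lt_im].
    rewrite subn0; apply: (bwd (Rung m) true) => //; first exact: leqnn.
    by rewrite /crossing /= ltnn.
  apply: (bwd (Rung (m - i.+1)) true) => //; first exact: leq_subr.
  have -> : (m - i.+1 = (m - i).-1)%N by lia.
  rewrite /crossing /=; have -> : ((m - i).-1 < m)%N by lia.
  by rewrite /= prednK ?subn_gt0 //; apply: IHi; exact: ltnW.
have rung_blue_f j : (j <= m)%N -> lifted (Rung j) (Blue false).
  elim: j => [|j IHj] le_jm.
    exact: (bwd (Rung 0) false (Blue false) isT isT (rung_blue_t 0%N isT)).
  by apply: (bwd (Rung j.+1) false) => //; exact/IHj/ltnW.
have rung_m_red_t : lifted (Rung m) (Red true).
  exact: (fwd (Slab 4) false Top isT isT (lifted_Top (isT : valid (Slab 4)))).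
have slab0_bot : lifted (Slab 0) Bot.
  have := fwd (Rung m) true (Red true) (leqnn m) isT rung_m_red_t.
  by rewrite /crossing /= ltnn.
have cap_red_f : lifted Cap (Red false).
  exact: (fwd (Slab 4) true Top isT isT (lifted_Top (isT : valid (Slab 4)))).
have cap_ok : valid Cap by [].
have cap_red_t : lifted Cap (Red true).
  exact: (fwd Cap true Top isT isT (lifted_Top cap_ok)).
have cap_bot : lifted Cap Bot by exact: (fwd Cap true (Red true) isT isT).
have slab_red_t i : (i < 5)%N -> lifted (Slab i) (Red true).
  elim: i => [_|i IHi lt_i4]; first exact: (fwd Cap false Top isT isT (lifted_Top cap_ok)).
  have lt_i5 : (i < 5)%N by exact: ltnW.
  have := fwd (Slab i) true (Red true) lt_i5 isT (IHi lt_i5).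
  by rewrite /crossing /= -ltnS lt_i4 ltn_eqF.
have slab_red_f i : (i < 5)%N -> lifted (Slab i) (Red false).
  elim: i => [_|i IHi lt_i4].
    have := fwd (Rung m) true Top (leqnn m) isT (lifted_Top (leqnn m : valid (Rung m))).
    by rewrite /crossing /= ltnn.
  have lt_i5 : (i < 5)%N by exact: ltnW.
  have := fwd (Slab i) false (Red false) lt_i5 isT (IHi lt_i5).
  by rewrite /crossing /= -ltnS lt_i4 ltn_eqF.
have rung_red_f j : (j <= m)%N -> lifted (Rung j) (Red false).
  case: j => [|j] le_jm.
    exact: (fwd (Rung 0) false Top isT isT (lifted_Top (isT : valid (Rung 0)))).
  have := fwd (Rung j) true Top (ltnW le_jm) isT (lifted_Top (ltnW le_jm : valid (Rung j))).
  by rewrite /crossing /= le_jm.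
have rung_red_t j : (j <= m)%N -> lifted (Rung j) (Red true).
  rewrite leq_eqVlt => /orP [/eqP -> //|lt_jm].
  exact: (fwd (Rung j.+1) false Top lt_jm isT (lifted_Top (lt_jm : valid (Rung j.+1)))).
have rung_bot j : (j <= m)%N -> lifted (Rung j) Bot.
  case: j => [|j] le_jm; first exact: (fwd (Rung 0) false (Red false) isT isT (rung_red_f _ _)).
  have := fwd (Rung j) true (Red true) (ltnW le_jm) isT (rung_red_t j (ltnW le_jm)).
  by rewrite /crossing /= le_jm.
elim/tetraP: t => x x_ok; case: e => [||b|b]; first exact: lifted_Top.
- case: x x_ok => [[|[|i]]||j] //= x_ok; last exact: rung_bot.
  by apply: slab_bot; move: x_ok; lia.
- case: x x_ok => [i||j] /= x_ok; case: b => //.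
  + exact: slab_red_t.
  + exact: slab_red_f.
  + exact: rung_red_t.
  + exact: rung_red_f.
case: x x_ok => [[|i]||j] /= x_ok; first by case: b.
- exact: slab_blue.
- by case: b.
- by case: b; [exact: rung_blue_t | exact: rung_blue_f].
Qed.

Definition adjacent (t t' : T) : Prop := exists i, t' = (glue (vd_tri tower) t i).1.

Lemma tower_connected : tri_connected (vd_tri tower).
Proof.
have adj_sym (t t' : T) : adjacent t t' -> adjacent t' t.
  by move=> [i ->]; exists ((glue (vd_tri tower) t i).2 i); rewrite glueK.
have step x b : valid x -> adjacent (enc x) (enc (above (x, b)).1).
  by move=> x_ok; exists (tface b); rewrite /= (vd_glue_top tower (enc x, b)) up_enc.
pose linked (t t' : T) := clos_refl_trans T adjacent t t'.
have linked_sym t t' : linked t t' -> linked t' t.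
  elim=> {t t'} [t t' /adj_sym|t|t1 t2 t3 _ l21 _ l32]; first exact: rt_step.
    exact: rt_refl.
  exact: rt_trans l32 l21.
have slab i : (i < 5)%N -> linked (enc (Slab 0)) (enc (Slab i)).
  elim: i => [|i IHi] lt_i; first exact: rt_refl.
  apply: rt_trans (IHi (ltnW lt_i)) _; apply: rt_step.
  by have := step (Slab i) true (ltnW lt_i); rewrite /= -ltnS lt_i.
have rung_down j : (j <= m)%N -> linked (enc (Rung 0)) (enc (Rung j)).
  elim: j => [|j IHj] le_jm; first exact: rt_refl.
  apply: rt_trans (IHj (ltnW le_jm)) _; apply: rt_step.
  by have := step (Rung j) true (ltnW le_jm); rewrite /= le_jm.
have all_linked t : linked (enc (Slab 0)) t.
  elim/tetraP: t => -[i||j] /= x_ok; first exact: slab.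
    apply: rt_trans (slab 4%N isT) _; apply: rt_step; exact: (step (Slab 4) true isT).
  apply: rt_trans (slab 4%N isT) _.
  apply: rt_trans (rt_step _ _ _ _ (step (Slab 4) false isT)) _.
  exact: rt_trans (linked_sym _ _ (rung_down m (leqnn m))) (rung_down j x_ok).
move=> t t'; exact: rt_trans (linked_sym _ _ (all_linked t)) (all_linked t').
Qed.

(** The rows of rungs 0 and 1 agree. There are at least two rungs as [m] is
positive. *)
Lemma tower_polynomial :
  veering_polynomial (vd_lifts rep_T_up rep_T_Top rep_T_Bot_inj tower_connected lifted_all) = 0.
Proof.
have ok0 : valid (Rung 0) by []. have ok1 : valid (Rung 1) by [].
apply: veering_polynomial_twin_rows (_ : enc (Rung 0) != enc (Rung 1)) _ _.
- by apply/eqP => /(congr1 dec); rewrite !encK.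
- by move=> u; rewrite !inE => /orP [] /eqP ->; rewrite /= /rep_T /height_T !encK.
by move=> b; rewrite /rep_T /height_T !encK.
Qed.

End Family.

Theorem corollary1p1 (k : nat) :
  exists (V : veering_triangulation (8 + k)) (C : fab_cover V) (B : lifts C),
    veering_polynomial B = 0.
Proof. by do 3 eexists; exact: (tower_polynomial k). Qed.
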